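(* Let $k$ be a field of characteristic $0$. For all integers $n\ge 2$ and all $d\in\mathbb{Z}$, the operads $n\text{-}Lie_d$ and $n\text{-}Com_{-d+n-2}$ are Koszul dual; that is, the Koszul dual operad $(n\text{-}Lie_d)^{!}$ is $n\text{-}Com_{-d+n-2}$.
   Context: Operads are operads in graded $k$-vector spaces with right $\Sigma_m$-actions and usual Koszul sign conventions; $\Sigma_m$ is the symmetric group and $Sgn$ the sign. For an $n$-ary operation $f$ of degree $d$ on a graded space, $f^{\sigma}(v_1,\dots,v_n)=\xi\, f(v_{\sigma^{-1}(1)},\dots,v_{\sigma^{-1}(n)})$, where $\xi$ is the Koszul sign of the permutation of the $v_i$. **$n$-quadratic operads.** A $\Sigma$-module is a sequence $E=(E(m))_{m\ge1}$ of right $k[\Sigma_m]$-modules (graded). $F(E)$ is the free operad on $E$ and $F(E)^{(2)}$ is its weight $2$ part (spanned by trees with exactly two vertices decorated by $E$). $n$-quadratic data is a pair $(E,R)$ with $E$ concentrated in arity $n$ and $R\subseteq F(E)^{(2)}$ a sub-$\Sigma$-module (necessarily in arity $2n-1$); the associated operad is $\mathcal{P}(E,R)=F(E)/(R)$, where $(R)$ is the operadic ideal generated by $R$. **Weight 2 part.** Suppose $E(n)$ is one-dimensional spanned by $\mu$, with trivial or sign action of $\Sigma_n$. Let $\Lambda_n^{2n-1}$ be the set of $(n-1)$-element subsets of $\{1,\dots,2n-1\}$. For $A\in\Lambda_n^{2n-1}$ put $\mu\circ_A\mu=(\mu\circ_1\mu)^{\sigma}$ for any even permutation $\sigma\in\Sigma_{2n-1}$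 with $\sigma^{-1}(\{n+1,\dots,2n-1\})=A$ (this does not depend on $\sigma$). The elements $\mu\circ_A\mu$, $A\in \Lambda_n^{2n-1}$, form a basis of $F(E)^{(2)}(2n-1)$, and for $\tau\in\Sigma_{2n-1}$ one has $(\mu\circ_A\mu)^{\tau}=\mu\circ_{\tau^{-1}(A)}\mu$ if $E(n)$ is trivial, and $(\mu\circ_A\mu)^{\tau}=Sgn(\tau)\,\mu\circ_{\tau^{-1}(A)}\mu$ if $E(n)$ is the sign representation. **Koszul dual.** $E^{\vee}$ is the $\Sigma$-module with $E^{\vee}(a)=\uparrow^{a-2}E^*(a)\otimes Sgn_a$, where $E^*(a)$ is the $k$-linear dual with the induced right action, $\uparrow$ is suspension (degree shift by $+1$), and $Sgn_a$ is the sign representation; so $f^\sigma(v)=Sgn(\sigma)f(v^{\sigma^{-1}})$. If $E$ is concentrated in arity $n$ and degree $d$, then $E^\vee$ is concentrated in arity $n$ and degree $-d+n-2$. For $E$ concentrated in arity $n$ with $E(n)$ one-dimensional and carrying the trivial or sign action of $\Sigma_n$, the pairing $\langle-,-\rangle:F(E^\vee)^{(2)}(2n-1)\otimes F(E)^{(2)}(2n-1)\to k$ is defined by $\langle \alpha\circ_A\beta,\mu\circ_B\nu\rangle=\alpha(\mu)\beta(\nu)$ if $A=B$ and $0$ otherwise. $R^\perp$ is the annihilator of $R$ in $F(E^\vee)^{(2)}$ under this pairing, and the Koszul dual is $\mathcal{P}(E,R)^{!}=\mathcal{P}(E^\vee,R^\perp)$. **The operad $n\text{-}Lie_d$.** It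 is the operad whose algebras are $n$-Lie algebras of degree $d$, given by $n\text{-}Lie_d=\mathcal{P}(E_{n,d},R_{n,d})$. Here $E_{n,d}$ is concentrated in arity $n$ with $E_{n,d}(n)=\uparrow^d k\nu$ and $\nu^\sigma=Sgn(\sigma)\nu$. With $v_A=\nu\circ_A\nu$, $R_{n,d}$ is the right $\Sigma_{2n-1}$-submodule of $F(E_{n,d})^{(2)}(2n-1)$ generated by $$r_{n,d}=v_{\{n+1,\dots,2n-1\}}+(-1)^n\sum_{i=1}^{n}v_{\{1,\dots,n\}\setminus\{i\}}.$$ (This encodes $[[v_1,\dots,v_n],v_{n+1},\dots,v_{2n-1}]=\sum_{i=1}^n\pm[v_1,\dots,[v_i,v_{n+1},\dots,v_{2n-1}],\dots,v_n]$, with Koszul signs, for a graded-antisymmetric $n$-ary bracket of degree $d$.) **The operad $n\text{-}Com_d$.** It is $n\text{-}Com_d=\mathcal{P}(H_{n,d},S_{n,d})$, where $H_{n,d}$ is concentrated in arity $n$ with $H_{n,d}(n)=\uparrow^d k\mu$ and $\mu^\sigma=\mu$. Let $C$ be the subgroup of $\Sigma_{2n-1}$ generated by the transpositions $(1,n+1),(2,n+2),\dots,(n-1,2n-1)$ (the column stabilizer of the Young tableau of shape $(n,n-1)$ with rows $1,\dots,n$ and $n+1,\dots,2n-1$). With $u_A=\mu\circ_A\mu$, $S_{n,d}$ is the right $\Sigma_{2n-1}$-submodule of $F(H_{n,d})^{(2)}(2n-1)$ generated by $$s_{n,d}=\sum_{\sigma\in C}Sgn(\sigma)\,u_{\{\sigma^{-1}(n+1),\dots,\sigma^{-1}(2n-1)\}}.$$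 Equivalently, its algebras are graded spaces with a graded-symmetric $n$-ary operation $m_n$ of degree $d$ satisfying $\sum_{\sigma\in C}Sgn(\sigma)(m_n\circ_1m_n)^\sigma=0$. One has $E_{n,d}^\vee=H_{n,-d+n-2}$ (with $\mu$ the dual basis element of $\nu$). *)

(* Defs.v *)
From HB Require Import structures.
From mathcomp Require Import all_boot all_order all_fingroup all_algebra zify.
From mathcomp Require Import boolp.

Set Implicit Arguments.
Unset Strict Implicit.
Unset Printing Implicit Defensive.

Import GRing.Theory.
Local Open Scope ring_scope.

(** Conventions.
    - Arities are at least 1: the index [m : nat] stands for arity [m.+1], so
      that composing arities m.+1 and n.+1 gives arity (m + n).+1.
    - Inputs are numbered from 0: 'I_m.+1 stands for {1, ..., m+1}.
    - A graded vector space is the family of its homogeneous components.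
    - In the symmetric group, the product used in the mathematical text is
      composition of functions; in MathComp [(s * t)%g x = t (s x)], so the
      text's product "s t" is [(t * s)%g]. *)

(** Elements of components with propositionally equal indices are compared in
    the total space of the family. *)
Definition hom (T : nat -> int -> Type) m d (x : T m d) :
    {p : nat * int & T p.1 p.2} :=
  existT (fun p : nat * int => T p.1 p.2) (m, d) x.
Arguments hom : clear implicits.

Definition sgn (k : fieldType) m (s : 'S_m) : k := (-1) ^+ odd_perm s.

Record smod (k : fieldType) := Smod {
  sm_car :> nat -> int -> lmodType k;
  sm_act : forall m d, 'S_m.+1 -> sm_car m d -> sm_car m d;
  sm_act_linear : forall m d s, linear (@sm_act m d s);
  sm_act1 : forall m d (x : sm_car m d), sm_act 1%g x = x;
  (* right action: (x^s)^t = x^(s o t), where s o t is (t * s)%g *)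
  sm_actM : forall m d s t (x : sm_car m d),
    sm_act t (sm_act s x) = sm_act (t * s)%g x }.
Arguments sm_act {k s0 m d}.

Definition shom (k : fieldType) (P : smod k) m d (x : P m d) :
    {p : nat * int & P p.1 p.2} := hom (fun m d => P m d) m d x.

Lemma shom_inj (k : fieldType) (P : smod k) m d : injective (@shom k P m d).
Proof.
move=> x y h.
exact: (@eq_from_Tagged _ (fun p : nat * int => P p.1 p.2 : Type) (m, d) x y h).
Qed.

Section BlockPerm.
Variables m n : nat.

(** When g (with n.+1 inputs) is plugged into input p of f (with m.+1 inputs),
    input q != p of f becomes input [outer_pos p q] of the composite, and input
    b of g becomes input p + b. *)
Definition outer_pos (p q : 'I_m.+1) : 'I_(m + n).+1 :=
  inord (if (q < p)%N then q : nat else (q + n)%N).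

Definition inner_pos (p : 'I_m.+1) (b : 'I_n.+1) : 'I_(m + n).+1 :=
  inord (p + b).

Lemma outer_posE p q :
  outer_pos p q = (if (q < p)%N then q : nat else (q + n)%N) :> nat.
Proof.
by have := ltn_ord p; have := ltn_ord q => hq hp; rewrite inordK //; case: ifP; lia.
Qed.

Lemma inner_posE p b : inner_pos p b = (p + b)%N :> nat.
Proof. by have := ltn_ord p; have := ltn_ord b => hb hp; rewrite inordK //; lia. Qed.

Definition block_fun (i : 'I_m.+1) (s : 'S_m.+1) (t : 'S_n.+1)
    (a : 'I_(m + n).+1) : 'I_(m + n).+1 :=
  if (a < i)%N then outer_pos (s i) (s (inord a))
  else if (a <= i + n)%N then inner_pos (s i) (t (inord (a - i)))
  else outer_pos (s i) (s (inord (a - n))).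

Lemma block_fun_inner i s t b :
  block_fun i s t (inner_pos i b) = inner_pos (s i) (t b).
Proof.
have := ltn_ord i; have := ltn_ord b => hb hi.
rewrite /block_fun inner_posE ltnNge leq_addr /= leq_add2l -ltnS hb.
by congr inner_pos; congr (t _); apply: val_inj; rewrite /= inordK; lia.
Qed.

Lemma block_fun_outer i s t j : j != i ->
  block_fun i s t (outer_pos i j) = outer_pos (s i) (s j).
Proof.
rewrite -val_eqE /= => hji; have := ltn_ord i; have := ltn_ord j => hj hi.
rewrite /block_fun outer_posE; case: (ltnP j i) => hlt.
  by rewrite hlt /= inord_val.
have -> : (j + n < i)%N = false by lia.
have -> : (j + n <= i + n)%N = false by lia.
by rewrite addnK inord_val.
Qed.

Lemma posP (i : 'I_m.+1) (a : 'I_(m + n).+1) :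
  (exists b, a = inner_pos i b) \/ (exists2 j, j != i & a = outer_pos i j).
Proof.
have := ltn_ord i; have := ltn_ord a => ha hi.
case: (ltnP a i) => h1.
  right; exists (inord a).
    by rewrite -val_eqE /= inordK; lia.
  by apply: ord_inj; rewrite outer_posE inordK ?h1 //; lia.
case: (leqP a (i + n)) => h2.
  left; exists (inord (a - i)); apply: ord_inj.
  by rewrite inner_posE inordK; lia.
right; exists (inord (a - n)).
  by rewrite -val_eqE /= inordK; lia.
apply: ord_inj; rewrite outer_posE inordK; last by lia.
have -> : (a - n < i)%N = false by lia.
by lia.
Qed.

Lemma block_funK i s t :
  cancel (block_fun i s t) (block_fun (s i) s^-1%g t^-1%g).
Proof.
move=> a; case: (posP i a) => [[b ->]|[j hj ->]].
  by rewrite !block_fun_inner !permK.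
by rewrite block_fun_outer // block_fun_outer ?permK // (inj_eq perm_inj).
Qed.

(** The permutation [s o_i t] for which f^s o_i g^t = (f o_(s i) g)^(s o_i t). *)
Definition block_perm i s t : 'S_(m + n).+1 :=
  perm (can_inj (block_funK i s t)).

End BlockPerm.

Record operad (k : fieldType) := Operad {
  op_smod :> smod k;
  op_id : op_smod 0%N 0;
  op_comp : forall m n d e, 'I_m.+1 -> op_smod m d -> op_smod n e ->
    op_smod (m + n)%N (d + e);
  op_comp_linl : forall m n d e i (y : op_smod n e),
    linear (fun x : op_smod m d => op_comp i x y);
  op_comp_linr : forall m n d e i (x : op_smod m d),
    linear (fun y : op_smod n e => op_comp i x y);
  op_idl : forall n e (x : op_smod n e), shom (op_comp ord0 op_id x) = shom x;
  op_idr : forall m d i (x : op_smod m d), shom (op_comp i x op_id) = shom x;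
  op_seq : forall m n p d e f (i : 'I_m.+1) (j : 'I_n.+1)
      (x : op_smod m d) (y : op_smod n e) (z : op_smod p f),
    shom (op_comp (inord (i + j)) (op_comp i x y) z) =
    shom (op_comp i x (op_comp j y z));
  op_par : forall m n p d e f (i l : 'I_m.+1)
      (x : op_smod m d) (y : op_smod n e) (z : op_smod p f), (i < l)%N ->
    shom (op_comp (inord (l + n)) (op_comp i x y) z) =
    shom ((-1) ^+ (`|e| * `|f|)%N *: op_comp (inord i) (op_comp l x z) y);
  op_equiv : forall m n d e (i : 'I_m.+1) s t
      (x : op_smod m d) (y : op_smod n e),
    op_comp i (sm_act s x) (sm_act t y) =
    sm_act (block_perm i s t) (op_comp (s i) x y) }.
Arguments op_id {k} o.
Arguments op_comp {k o m n d e}.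

Record operad_morphism (k : fieldType) (P Q : operad k)
    (f : forall m d, P m d -> Q m d) : Prop := {
  om_linear : forall m d, linear (f m d);
  om_act : forall m d s (x : P m d), f m d (sm_act s x) = sm_act s (f m d x);
  om_id : f 0%N 0 (op_id P) = op_id Q;
  om_comp : forall m n d e (i : 'I_m.+1) (x : P m d) (y : P n e),
    f _ _ (op_comp i x y) = op_comp i (f m d x) (f n e y) }.

Definition operad_isomorphism (k : fieldType) (P Q : operad k)
    (f : forall m d, P m d -> Q m d) : Prop :=
  operad_morphism f /\ forall m d, bijective (f m d).

Section Sub.
Variable k : fieldType.

Definition family (P : smod k) := forall m d, P m d -> Prop.

Definition sub_family (P : smod k) (M N : family P) : Prop :=
  forall m d (x : P m d), M m d x -> N m d x.

Record sub_smod (P : smod k) (M : family P) : Prop := {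
  ss0 : forall m d, M m d 0;
  ss_lin : forall m d a (x y : P m d), M m d x -> M m d y -> M m d (a *: x + y);
  ss_act : forall m d s (x : P m d), M m d x -> M m d (sm_act s x) }.

Definition sub_generated (P : smod k) (G : family P) : family P :=
  fun m d x => forall M, sub_smod M -> sub_family G M -> M m d x.

Definition singleton (P : smod k) m d (r : P m d) : family P :=
  fun m' d' x => shom x = shom r.

Record operadic_ideal (P : operad k) (I : family P) : Prop := {
  oi_sub : sub_smod I;
  oi_compl : forall m n d e (i : 'I_m.+1) (x : P m d) (y : P n e),
    I m d x -> I _ _ (op_comp i x y);
  oi_compr : forall m n d e (i : 'I_m.+1) (x : P m d) (y : P n e),
    I n e y -> I _ _ (op_comp i x y) }.

Definition ideal_generated (P : operad k) (G : family P) : family P :=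
  fun m d x => forall I, operadic_ideal I -> sub_family G I -> I m d x.

Lemma sub_generated_sub (P : smod k) (G : family P) :
  sub_smod (sub_generated G).
Proof.
split=> [m d M hM _|m d a x y hx hy M hM hG|m d s x hx M hM hG].
- exact: ss0 hM _ _.
- by apply: (ss_lin hM); [apply: hx|apply: hy].
- by apply: (ss_act hM); apply: hx.
Qed.

Lemma ideal_generated_ideal (P : operad k) (G : family P) :
  operadic_ideal (ideal_generated G).
Proof.
split; first split.
- by move=> m d I hI _; apply: (ss0 (oi_sub hI)).
- move=> m d a x y hx hy I hI hG.
  by apply: (ss_lin (oi_sub hI)); [apply: hx|apply: hy].
- by move=> m d s x hx I hI hG; apply: (ss_act (oi_sub hI)); apply: hx.
- by move=> m n d e i x y hx I hI hG; apply: (oi_compl hI); apply: hx.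
- by move=> m n d e i x y hx I hI hG; apply: (oi_compr hI); apply: hx.
Qed.

End Sub.

(** The operations of an operad, without the axioms. *)
Record operad_ops (k : fieldType) := OperadOps {
  oo_car :> nat -> int -> Type;
  oo_zero : forall m d, oo_car m d;
  oo_add : forall m d, oo_car m d -> oo_car m d -> oo_car m d;
  oo_scale : forall m d, k -> oo_car m d -> oo_car m d;
  oo_act : forall m d, 'S_m.+1 -> oo_car m d -> oo_car m d;
  oo_id : oo_car 0%N 0;
  oo_comp : forall m n d e, 'I_m.+1 -> oo_car m d -> oo_car n e ->
    oo_car (m + n)%N (d + e) }.
Arguments oo_zero {k o}.
Arguments oo_add {k o m d}.
Arguments oo_scale {k o m d}.
Arguments oo_act {k o m d}.
Arguments oo_id {k} o.
Arguments oo_comp {k o m n d e}.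

Definition ohom (k : fieldType) (T : operad_ops k) m d (x : T m d) :
    {p : nat * int & T p.1 p.2} := hom (fun m d => T m d) m d x.

(** Congruences modulo which the operad axioms hold. *)
Record operad_cong (k : fieldType) (T : operad_ops k)
    (R : {p : nat * int & T p.1 p.2} -> {p : nat * int & T p.1 p.2} -> Prop) :
    Prop := {
  oc_tag : forall X Y, R X Y -> tag X = tag Y;
  oc_refl : forall X, R X X;
  oc_sym : forall X Y, R X Y -> R Y X;
  oc_trans : forall X Y Z, R X Y -> R Y Z -> R X Z;
  oc_add : forall m d (x x' y y' : T m d), R (ohom x) (ohom x') ->
    R (ohom y) (ohom y') -> R (ohom (oo_add x y)) (ohom (oo_add x' y'));
  oc_scale : forall m d a (x x' : T m d), R (ohom x) (ohom x') ->
    R (ohom (oo_scale a x)) (ohom (oo_scale a x'));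
  oc_act : forall m d s (x x' : T m d), R (ohom x) (ohom x') ->
    R (ohom (oo_act s x)) (ohom (oo_act s x'));
  oc_comp : forall m n d e (i : 'I_m.+1) (x x' : T m d) (y y' : T n e),
    R (ohom x) (ohom x') -> R (ohom y) (ohom y') ->
    R (ohom (oo_comp i x y)) (ohom (oo_comp i x' y'));
  oc_addA : forall m d (x y z : T m d),
    R (ohom (oo_add x (oo_add y z))) (ohom (oo_add (oo_add x y) z));
  oc_addC : forall m d (x y : T m d),
    R (ohom (oo_add x y)) (ohom (oo_add y x));
  oc_add0 : forall m d (x : T m d), R (ohom (oo_add (oo_zero m d) x)) (ohom x);
  oc_scale0 : forall m d (x : T m d), R (ohom (oo_scale 0 x)) (ohom (oo_zero m d));
  oc_scale1 : forall m d (x : T m d), R (ohom (oo_scale 1 x)) (ohom x);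
  oc_scaleA : forall m d a b (x : T m d),
    R (ohom (oo_scale a (oo_scale b x))) (ohom (oo_scale (a * b) x));
  oc_scaleDr : forall m d a (x y : T m d),
    R (ohom (oo_scale a (oo_add x y)))
      (ohom (oo_add (oo_scale a x) (oo_scale a y)));
  oc_scaleDl : forall m d a b (x : T m d),
    R (ohom (oo_scale (a + b) x))
      (ohom (oo_add (oo_scale a x) (oo_scale b x)));
  oc_act_lin : forall m d s a (x y : T m d),
    R (ohom (oo_act s (oo_add (oo_scale a x) y)))
      (ohom (oo_add (oo_scale a (oo_act s x)) (oo_act s y)));
  oc_act1 : forall m d (x : T m d), R (ohom (oo_act 1%g x)) (ohom x);
  oc_actM : forall m d s t (x : T m d),
    R (ohom (oo_act t (oo_act s x))) (ohom (oo_act (t * s)%g x));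
  oc_comp_linl : forall m n d e (i : 'I_m.+1) a (x x' : T m d) (y : T n e),
    R (ohom (oo_comp i (oo_add (oo_scale a x) x') y))
      (ohom (oo_add (oo_scale a (oo_comp i x y)) (oo_comp i x' y)));
  oc_comp_linr : forall m n d e (i : 'I_m.+1) a (x : T m d) (y y' : T n e),
    R (ohom (oo_comp i x (oo_add (oo_scale a y) y')))
      (ohom (oo_add (oo_scale a (oo_comp i x y)) (oo_comp i x y')));
  oc_idl : forall n e (x : T n e), R (ohom (oo_comp ord0 (oo_id T) x)) (ohom x);
  oc_idr : forall m d i (x : T m d), R (ohom (oo_comp i x (oo_id T))) (ohom x);
  oc_seq : forall m n p d e f (i : 'I_m.+1) (j : 'I_n.+1)
      (x : T m d) (y : T n e) (z : T p f),
    R (ohom (oo_comp (inord (i + j)) (oo_comp i x y) z))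
      (ohom (oo_comp i x (oo_comp j y z)));
  oc_par : forall m n p d e f (i l : 'I_m.+1)
      (x : T m d) (y : T n e) (z : T p f), (i < l)%N ->
    R (ohom (oo_comp (inord (l + n)) (oo_comp i x y) z))
      (ohom (oo_scale ((-1) ^+ (`|e| * `|f|)%N)
                      (oo_comp (inord i) (oo_comp l x z) y)));
  oc_equiv : forall m n d e (i : 'I_m.+1) s t (x : T m d) (y : T n e),
    R (ohom (oo_comp i (oo_act s x) (oo_act t y)))
      (ohom (oo_act (block_perm i s t) (oo_comp (s i) x y))) }.

Section Quotient.
Variables (k : fieldType) (T : operad_ops k).
Variable R : {p : nat * int & T p.1 p.2} -> {p : nat * int & T p.1 p.2} -> Prop.
Hypothesis HR : operad_cong R.

Record qcar m d := Qcar {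
  qset : T m d -> Prop;
  qsetP : exists t : T m d, qset = fun u => R (ohom t) (ohom u) }.

Definition qpi m d (t : T m d) : qcar m d := Qcar (ex_intro _ t erefl).

Definition qrepr m d (x : qcar m d) : T m d := projT1 (cid (qsetP x)).

Lemma qcar_eq m d (x y : qcar m d) : qset x = qset y -> x = y.
Proof.
case: x y => [A hA] [B hB] /= h; subst B.
by congr Qcar; apply: Prop_irrelevance.
Qed.

Lemma qpi_eq m d (t u : T m d) : R (ohom t) (ohom u) -> qpi t = qpi u.
Proof.
move=> h; apply: qcar_eq => /=; apply/funext => v; apply/propext; split.
- exact/(oc_trans HR)/(oc_sym HR).
- exact: (oc_trans HR).
Qed.

Lemma qpi_inj m d (t u : T m d) : qpi t = qpi u -> R (ohom t) (ohom u).
Proof.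
move=> /(congr1 (@qset m d)) /= /(congr1 (@^~ u)) ->; exact: (oc_refl HR).
Qed.

Lemma qreprK m d : cancel (@qrepr m d) (@qpi m d).
Proof.
by move=> x; apply: qcar_eq => /=; rewrite /qrepr; case: cid => t /= ->.
Qed.

Lemma qrepr_pi m d (t : T m d) : R (ohom (qrepr (qpi t))) (ohom t).
Proof. by apply: qpi_inj; rewrite qreprK. Qed.

Definition qzero m d : qcar m d := qpi (oo_zero m d).
Definition qadd m d (x y : qcar m d) := qpi (oo_add (qrepr x) (qrepr y)).
Definition qscale m d a (x : qcar m d) := qpi (oo_scale a (qrepr x)).
Definition qopp m d (x : qcar m d) := qscale (-1) x.
Definition qact m d s (x : qcar m d) := qpi (oo_act s (qrepr x)).
Definition qcomp m n d e i (x : qcar m d) (y : qcar n e) :=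
  qpi (oo_comp i (qrepr x) (qrepr y)).

Lemma qpi_add m d (t u : T m d) : qadd (qpi t) (qpi u) = qpi (oo_add t u).
Proof. by apply/qpi_eq/(oc_add HR); apply: qrepr_pi. Qed.
Lemma qpi_scale m d a (t : T m d) : qscale a (qpi t) = qpi (oo_scale a t).
Proof. by apply/qpi_eq/(oc_scale HR); apply: qrepr_pi. Qed.
Lemma qpi_act m d s (t : T m d) : qact s (qpi t) = qpi (oo_act s t).
Proof. by apply/qpi_eq/(oc_act HR); apply: qrepr_pi. Qed.
Lemma qpi_comp m n d e i (t : T m d) (u : T n e) :
  qcomp i (qpi t) (qpi u) = qpi (oo_comp i t u).
Proof. by apply/qpi_eq/(oc_comp HR); apply: qrepr_pi. Qed.
Definition qpiE := (qpi_add, qpi_scale, qpi_act, qpi_comp).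

Lemma qaddA m d : associative (@qadd m d).
Proof.
move=> x y z; rewrite -[x]qreprK -[y]qreprK -[z]qreprK !qpiE.
exact/qpi_eq/(oc_addA HR).
Qed.
Lemma qaddC m d : commutative (@qadd m d).
Proof.
by move=> x y; rewrite -[x]qreprK -[y]qreprK !qpiE; apply/qpi_eq/(oc_addC HR).
Qed.
Lemma qadd0 m d : left_id (qzero m d) (@qadd m d).
Proof.
by move=> x; rewrite -[x]qreprK !qpiE; apply/qpi_eq/(oc_add0 HR).
Qed.
Lemma qscale1 m d : left_id 1 (@qscale m d).
Proof.
by move=> x; rewrite -[x]qreprK !qpiE; apply/qpi_eq/(oc_scale1 HR).
Qed.
Lemma qscaleA m d a b (x : qcar m d) :
  qscale a (qscale b x) = qscale (a * b) x.
Proof.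
by rewrite -[x]qreprK !qpiE; apply/qpi_eq/(oc_scaleA HR).
Qed.
Lemma qscaleDr m d : right_distributive (@qscale m d) (@qadd m d).
Proof.
move=> a x y; rewrite -[x]qreprK -[y]qreprK !qpiE.
exact/qpi_eq/(oc_scaleDr HR).
Qed.
Lemma qscaleDl m d (x : qcar m d) :
  {morph (@qscale m d)^~ x : a b / a + b >-> qadd a b}.
Proof.
by move=> a b; rewrite -[x]qreprK !qpiE; apply/qpi_eq/(oc_scaleDl HR).
Qed.
Lemma qaddN m d : left_inverse (qzero m d) (@qopp m d) (@qadd m d).
Proof.
move=> x; rewrite /qopp -{2}[x]qscale1 -qscaleDl addNr -[x]qreprK !qpiE.
exact/qpi_eq/(oc_scale0 HR).
Qed.

End Quotient.

(** The congruence proof is a parameter of the carrier, so that the algebraic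
    structures can be inferred from it. *)
Definition quot (k : fieldType) (T : operad_ops k) R
  (HR : @operad_cong k T R) m d := qcar R m d.

Section QuotientOperad.
Variables (k : fieldType) (T : operad_ops k).
Variable R : {p : nat * int & T p.1 p.2} -> {p : nat * int & T p.1 p.2} -> Prop.
Hypothesis HR : operad_cong R.

HB.instance Definition _ m d := gen_eqMixin (quot HR m d).
HB.instance Definition _ m d := gen_choiceMixin (quot HR m d).
HB.instance Definition _ m d := GRing.isZmodule.Build (quot HR m d)
  (@qaddA _ _ _ HR m d) (@qaddC _ _ _ HR m d)
  (@qadd0 _ _ _ HR m d) (@qaddN _ _ _ HR m d).
HB.instance Definition _ m d := GRing.Zmodule_isLmodule.Build k (quot HR m d)
  (@qscaleA _ _ _ HR m d) (@qscale1 _ _ _ HR m d)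
  (@qscaleDr _ _ _ HR m d) (@qscaleDl _ _ _ HR m d).

Definition quot_pi m d (t : T m d) : quot HR m d := qpi R t.

Lemma quot_piP m d (x : quot HR m d) : exists t, x = quot_pi t.
Proof. by exists (qrepr x); rewrite /quot_pi qreprK. Qed.

Lemma quot_pi_eq m d (t u : T m d) :
  quot_pi t = quot_pi u <-> R (ohom t) (ohom u).
Proof. by split; [apply: qpi_inj|apply: qpi_eq]. Qed.

Lemma quot_linE m d a (t u : T m d) :
  a *: quot_pi t + quot_pi u = quot_pi (oo_add (oo_scale a t) u).
Proof.
rewrite -[LHS]/(qadd (qscale a (qpi R t)) (qpi R u)).
by rewrite (qpi_scale HR) (qpi_add HR).
Qed.

Lemma quot_scaleE m d a (t : T m d) :
  a *: quot_pi t = quot_pi (oo_scale a t).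
Proof. exact: (qpi_scale HR). Qed.

Definition quot_act m d s (x : quot HR m d) : quot HR m d := qact s x.
Definition quot_comp m n d e i (x : quot HR m d) (y : quot HR n e) :
  quot HR (m + n)%N (d + e) := qcomp i x y.

Lemma quot_actE m d s (t : T m d) :
  quot_act s (quot_pi t) = quot_pi (oo_act s t).
Proof. exact: (qpi_act HR). Qed.

Lemma quot_compE m n d e i (t : T m d) (u : T n e) :
  quot_comp i (quot_pi t) (quot_pi u) = quot_pi (oo_comp i t u).
Proof. exact: (qpi_comp HR). Qed.

Lemma quot_act_linear m d s : linear (@quot_act m d s).
Proof.
move=> a x y; case: (quot_piP x) => t ->; case: (quot_piP y) => u ->.
rewrite quot_linE !quot_actE quot_linE.
exact/quot_pi_eq/(oc_act_lin HR).
Qed.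

Lemma quot_act1 m d (x : quot HR m d) : quot_act 1%g x = x.
Proof.
by case: (quot_piP x) => t ->; rewrite quot_actE; apply/quot_pi_eq/(oc_act1 HR).
Qed.

Lemma quot_actM m d s t (x : quot HR m d) :
  quot_act t (quot_act s x) = quot_act (t * s)%g x.
Proof.
case: (quot_piP x) => u ->; rewrite !quot_actE.
exact/quot_pi_eq/(oc_actM HR).
Qed.

Definition quot_smod : smod k :=
  @Smod k (fun m d => quot HR m d) quot_act quot_act_linear quot_act1 quot_actM.

Lemma quot_hom m d m' d' (t : T m d) (u : T m' d') :
  R (ohom t) (ohom u) ->
  @shom k quot_smod m d (quot_pi t) = @shom k quot_smod m' d' (quot_pi u).
Proof.
move=> h; have [em ed] := oc_tag HR h; subst m' d'.
by congr shom; apply/quot_pi_eq.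
Qed.

Lemma quot_comp_linl m n d e i (y : quot HR n e) :
  linear (fun x : quot HR m d => quot_comp i x y).
Proof.
move=> a x x'; case: (quot_piP x) => t ->; case: (quot_piP x') => u ->.
case: (quot_piP y) => v ->; rewrite quot_linE !quot_compE quot_linE.
exact/quot_pi_eq/(oc_comp_linl HR).
Qed.

Lemma quot_comp_linr m n d e i (x : quot HR m d) :
  linear (fun y : quot HR n e => quot_comp i x y).
Proof.
move=> a y y'; case: (quot_piP x) => t ->; case: (quot_piP y) => u ->.
case: (quot_piP y') => v ->; rewrite quot_linE !quot_compE quot_linE.
exact/quot_pi_eq/(oc_comp_linr HR).
Qed.

Definition quot_operad : operad k.
Proof.
refine (@Operad k quot_smod (quot_pi (oo_id T)) quot_comp
  quot_comp_linl quot_comp_linr _ _ _ _ _).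
- move=> n e x; case: (quot_piP x) => t ->; rewrite quot_compE.
  exact/quot_hom/(oc_idl HR).
- move=> n e i x; case: (quot_piP x) => t ->; rewrite quot_compE.
  exact/quot_hom/(oc_idr HR).
- move=> m n p d e f i j x y z.
  case: (quot_piP x) => t ->; case: (quot_piP y) => u ->.
  case: (quot_piP z) => v ->; rewrite !quot_compE.
  exact/quot_hom/(oc_seq HR).
- move=> m n p d e f i l x y z il.
  case: (quot_piP x) => t ->; case: (quot_piP y) => u ->.
  case: (quot_piP z) => v ->; rewrite !quot_compE quot_scaleE.
  exact/quot_hom/(oc_par HR).
- move=> m n d e i s t x y.
  case: (quot_piP x) => u ->; case: (quot_piP y) => v ->.
  rewrite -[LHS]/(quot_comp i (quot_act s _) (quot_act t _)).
  rewrite -[RHS]/(quot_act _ (quot_comp (s i) _ _)).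
  rewrite (quot_compE (s i)) !quot_actE quot_compE.
  exact/quot_pi_eq/(oc_equiv HR).
Defined.

End QuotientOperad.

Section FreeOperad.
Variables (k : fieldType) (E : smod k).

Inductive term : nat -> int -> Type :=
| t_gen m d : E m d -> term m d
| t_zero m d : term m d
| t_add m d : term m d -> term m d -> term m d
| t_scale m d : k -> term m d -> term m d
| t_act m d : 'S_m.+1 -> term m d -> term m d
| t_id : term 0 0
| t_comp m n d e : 'I_m.+1 -> term m d -> term n e -> term (m + n) (d + e).

Definition term_ops : operad_ops k :=
  @OperadOps k term t_zero t_add t_scale t_act t_id t_comp.

(** The relations making [t_gen] a map of Sigma-modules. *)
Record gen_compat
    (R : {p : nat * int & term p.1 p.2} -> {p : nat * int & term p.1 p.2} -> Prop)
    : Prop := {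
  gc_lin : forall m d a (x y : E m d),
    R (@ohom k term_ops m d (t_gen (a *: x + y)))
      (@ohom k term_ops m d (t_add (t_scale a (t_gen x)) (t_gen y)));
  gc_act : forall m d s (x : E m d),
    R (@ohom k term_ops m d (t_gen (sm_act s x)))
      (@ohom k term_ops m d (t_act s (t_gen x))) }.

Definition free_rel (X Y : {p : nat * int & term p.1 p.2}) : Prop :=
  forall R, @operad_cong k term_ops R -> gen_compat R -> R X Y.

Lemma tag_cong : @operad_cong k term_ops (fun X Y => tag X = tag Y).
Proof.
split=> //=.
- by move=> X Y Z -> ->.
- by move=> *; rewrite add0n add0r.
- by move=> *; rewrite addn0 addr0.
- by move=> *; rewrite addnA addrA.
- by move=> *; rewrite addnAC addrAC.
Qed.

Lemma free_cong : @operad_cong k term_ops free_rel.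
Proof.
split; try by move=> * R HR gR; case: (HR); eauto.
- move=> X Y h; apply: (h (fun X Y => tag X = tag Y)); first exact: tag_cong.
  by split.
- by move=> X Y h R HR gR; apply: (oc_sym HR); apply: h.
- by move=> X Y Z h h' R HR gR; apply: (oc_trans HR (h R HR gR)); apply: h'.
- move=> m d x x' y y' h h' R HR gR.
  by apply: (oc_add HR); [apply: h | apply: h'].
- by move=> m d a x x' h R HR gR; apply: (oc_scale HR); apply: h.
- by move=> m d s x x' h R HR gR; apply: (oc_act HR); apply: h.
- move=> m n d e i x x' y y' h h' R HR gR.
  by apply: (oc_comp HR); [apply: h | apply: h'].
Qed.

Definition free_operad : operad k := quot_operad free_cong.

Definition gen m d (x : E m d) : free_operad m d :=
  @quot_pi k term_ops _ free_cong m d (t_gen x).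

(** The part spanned by the trees with exactly two vertices. *)
Inductive two_vertices : family free_operad :=
| TwoVertices m n d e (i : 'I_m.+1) (x : E m d) (y : E n e) :
    two_vertices (op_comp i (gen x) (gen y)).

Definition weight2 : family free_operad := sub_generated two_vertices.

End FreeOperad.

Section OperadQuotient.
Variables (k : fieldType) (P : operad k) (I : family P).
Hypothesis HI : operadic_ideal I.

Definition ops_of_operad : operad_ops k :=
  @OperadOps k (fun m d => P m d) (fun m d => 0) (fun m d => +%R)
    (fun m d => *:%R) (fun m d s => sm_act s) (op_id P)
    (fun m n d e i => op_comp i).

Definition ideal_rel (X Y : {p : nat * int & P p.1 p.2}) : Prop :=
  tag X = tag Y /\ I (tagged X - tagged_as X Y).

Lemma ideal_relE m d (x y : P m d) :
  ideal_rel (@ohom k ops_of_operad m d x) (@ohom k ops_of_operad m d y) <->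
  I (x - y).
Proof.
rewrite /ideal_rel /ohom /hom /=.
have -> : tagged_as (existT (fun p : nat * int => P p.1 p.2) (m, d) x)
                    (existT (fun p : nat * int => P p.1 p.2) (m, d) y) = y.
  exact: (@tagged_asE _ (fun p : nat * int => P p.1 p.2) (existT _ (m, d) x) y).
by split=> [[]|].
Qed.

Lemma ideal_rel_refl X : ideal_rel X X.
Proof.
case: X => [[m d] x]; apply/(@ideal_relE m d x x).
by rewrite subrr; apply: (ss0 (oi_sub HI)).
Qed.

Lemma ideal_rel_tag X Y : ideal_rel X Y -> exists m d (x y : P m d),
  [/\ X = @ohom k ops_of_operad m d x, Y = @ohom k ops_of_operad m d y
    & I (x - y)].
Proof.
case: X Y => [[m d] x] [[m' d'] y] h; have [em ed] := (proj1 h : (m, d) = (m', d')).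
by subst m' d'; exists m, d, x, y; split=> //; apply/ideal_relE.
Qed.

Lemma ideal_add m d (x y : P m d) : I x -> I y -> I (x + y).
Proof. by move=> hx hy; rewrite -[x]scale1r; apply: (ss_lin (oi_sub HI)). Qed.

Lemma ideal_scale m d a (x : P m d) : I x -> I (a *: x).
Proof.
move=> hx; rewrite -[_ *: _]addr0.
by apply: (ss_lin (oi_sub HI)) => //; apply: (ss0 (oi_sub HI)).
Qed.

Lemma linearB_of (U V : lmodType k) (f : U -> V) : linear f ->
  forall x y, f (x - y) = f x - f y.
Proof. by move=> h x y; rewrite addrC -scaleN1r h scaleN1r addrC. Qed.

Lemma ideal_rel_eq (X Y : {p : nat * int & P p.1 p.2}) : X = Y -> ideal_rel X Y.
Proof. by move=> ->; apply: ideal_rel_refl. Qed.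

Lemma ideal_cong : @operad_cong k ops_of_operad ideal_rel.
Proof.
split.
- by move=> X Y [].
- exact: ideal_rel_refl.
- move=> X Y /ideal_rel_tag[m [d [x [y [-> -> h]]]]]; apply/ideal_relE.
  by rewrite -opprB -scaleN1r; apply: ideal_scale.
- move=> X Y Z /ideal_rel_tag[m [d [x [y [-> -> h]]]]].
  case: Z => [[m' d'] z] h'; have [em ed] := (proj1 h' : (m, d) = (m', d')).
  subst m' d'; move: h' => /(@ideal_relE m d y z) h'.
  apply/(@ideal_relE m d x z); rewrite -(subrK y x) -addrA.
  exact: ideal_add.
- move=> m d x x' y y' /ideal_relE h /ideal_relE h'; apply/ideal_relE => /=.
  by rewrite opprD addrACA; apply: ideal_add.
- move=> m d a x x' /ideal_relE h; apply/ideal_relE => /=.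
  by rewrite -scalerBr; apply: ideal_scale.
- move=> m d s x x' /ideal_relE h; apply/ideal_relE => /=.
  rewrite -(linearB_of (sm_act_linear _)); exact: (ss_act (oi_sub HI)).
- move=> m n d e i x x' y y' /ideal_relE h /ideal_relE h'; apply/ideal_relE => /=.
  rewrite -(subrK (op_comp i x' y) (op_comp i x y)) -addrA.
  apply: ideal_add.
    rewrite -(linearB_of (@op_comp_linl k P m n d e i y)).
    exact: (oi_compl HI).
  rewrite -(linearB_of (@op_comp_linr k P m n d e i x')).
  exact: (oi_compr HI).
- by move=> m d x y z; apply: ideal_rel_eq; rewrite /= addrA.
- by move=> m d x y; apply: ideal_rel_eq; rewrite /= addrC.
- by move=> m d x; apply: ideal_rel_eq; rewrite /= add0r.
- by move=> m d x; apply: ideal_rel_eq; rewrite /= scale0r.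
- by move=> m d x; apply: ideal_rel_eq; rewrite /= scale1r.
- by move=> m d a b x; apply: ideal_rel_eq; rewrite /= scalerA.
- by move=> m d a x y; apply: ideal_rel_eq; rewrite /= scalerDr.
- by move=> m d a b x; apply: ideal_rel_eq; rewrite /= scalerDl.
- by move=> m d s a x y; apply: ideal_rel_eq; rewrite /= sm_act_linear.
- by move=> m d x; apply: ideal_rel_eq; rewrite /= sm_act1.
- by move=> m d s t x; apply: ideal_rel_eq; rewrite /= sm_actM.
- move=> m n d e i a x x' y; apply: ideal_rel_eq; congr (@ohom k ops_of_operad).
  exact: (@op_comp_linl k P m n d e i y).
- move=> m n d e i a x y y'; apply: ideal_rel_eq; congr (@ohom k ops_of_operad).
  exact: (@op_comp_linr k P m n d e i x).
- by move=> n e x; apply: ideal_rel_eq; apply: (op_idl x).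
- by move=> m d i x; apply: ideal_rel_eq; apply: (op_idr i x).
- by move=> m n p d e f i j x y z; apply: ideal_rel_eq; apply: (op_seq i j x y z).
- move=> m n p d e f i l x y z il; apply: ideal_rel_eq.
  exact: (op_par x y z il).
- move=> m n d e i s t x y; apply: ideal_rel_eq; congr (@ohom k ops_of_operad).
  exact: op_equiv.
Qed.

Definition operad_quotient : operad k := quot_operad ideal_cong.

Definition operad_proj m d (x : P m d) : operad_quotient m d :=
  @quot_pi k ops_of_operad _ ideal_cong m d x.

End OperadQuotient.

Section Quadratic.
Variable k : fieldType.

Definition quadratic_operad (E : smod k) (R : family (free_operad E)) :
    operad k :=
  operad_quotient (ideal_generated_ideal R).

Definition quadratic_gen (E : smod k) (R : family (free_operad E)) m d
    (x : E m d) : quadratic_operad R m d :=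
  operad_proj (ideal_generated_ideal R) (gen x).

Definition concentrated_in_arity (E : smod k) (n : nat) : Prop :=
  forall m d (x : E m d), m.+1 <> n -> x = 0.

Record quadratic_data (n : nat) := QuadraticData {
  qd_gens : smod k;
  qd_rels : family (free_operad qd_gens);
  qd_conc : concentrated_in_arity qd_gens n;
  qd_sub : sub_smod qd_rels;
  qd_weight2 : sub_family qd_rels (@weight2 k qd_gens) }.

Section CircAt.
Variable n : nat.

(** {n+1, ..., 2n-1} *)
Definition last_block : {set 'I_(n.-1 + n.-1).+1} :=
  [set j : 'I_(n.-1 + n.-1).+1 | (n <= j)%N].

(** Some even s with s^-1({n+1, ..., 2n-1}) = A. *)
Definition even_perm_at (A : {set 'I_(n.-1 + n.-1).+1}) :
    'S_(n.-1 + n.-1).+1 :=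
  odflt 1%g [pick s : 'S_(n.-1 + n.-1).+1 |
    ~~ odd_perm s && (s @^-1: last_block == A)].

Definition circ_at (E : smod k) (A : {set 'I_(n.-1 + n.-1).+1}) d e
    (x : E n.-1 d) (y : E n.-1 e) : free_operad E (n.-1 + n.-1)%N (d + e) :=
  sm_act (even_perm_at A) (op_comp ord0 (gen x) (gen y)).

End CircAt.

Record dual_space (V : lmodType k) := DualSpace {
  dual_fun :> V -> k^o;
  dual_linear : linear dual_fun }.

Section DualSpace.
Variable V : lmodType k.
Implicit Types f g : dual_space V.

Lemma dual_ext f g : (forall x, f x = g x) -> f = g.
Proof.
case: f g => [f hf] [g hg] /= /funext e; subst g.
by congr DualSpace; apply: Prop_irrelevance.
Qed.

Lemma dual_zero_linear : linear (fun _ : V => 0 : k^o).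
Proof. by move=> a x y; rewrite scaler0 addr0. Qed.
Lemma dual_add_linear f g : linear (fun x => f x + g x : k^o).
Proof. by move=> a x y; rewrite !dual_linear scalerDr addrACA. Qed.
Lemma dual_scale_linear a f : linear (fun x => a * f x : k^o).
Proof.
by move=> b x y; rewrite dual_linear mulrDr /GRing.scale /= mulrCA.
Qed.

Definition dual_zero := DualSpace dual_zero_linear.
Definition dual_add f g := DualSpace (dual_add_linear f g).
Definition dual_scale a f := DualSpace (dual_scale_linear a f).
Definition dual_opp f := dual_scale (-1) f.

Lemma dual_addA : associative dual_add.
Proof. by move=> f g h; apply: dual_ext => x /=; rewrite addrA. Qed.
Lemma dual_addC : commutative dual_add.
Proof. by move=> f g; apply: dual_ext => x /=; rewrite addrC. Qed.
Lemma dual_add0 : left_id dual_zero dual_add.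
Proof. by move=> f; apply: dual_ext => x /=; rewrite add0r. Qed.
Lemma dual_addN : left_inverse dual_zero dual_opp dual_add.
Proof. by move=> f; apply: dual_ext => x /=; rewrite mulN1r addNr. Qed.
Lemma dual_scaleA a b f : dual_scale a (dual_scale b f) = dual_scale (a * b) f.
Proof. by apply: dual_ext => x /=; rewrite mulrA. Qed.
Lemma dual_scale1 : left_id 1 dual_scale.
Proof. by move=> f; apply: dual_ext => x /=; rewrite mul1r. Qed.
Lemma dual_scaleDr : right_distributive dual_scale dual_add.
Proof. by move=> a f g; apply: dual_ext => x /=; rewrite mulrDr. Qed.
Lemma dual_scaleDl f : {morph dual_scale^~ f : a b / a + b >-> dual_add a b}.
Proof. by move=> a b; apply: dual_ext => x /=; rewrite mulrDl. Qed.

HB.instance Definition _ := gen_eqMixin (dual_space V).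
HB.instance Definition _ := gen_choiceMixin (dual_space V).
HB.instance Definition _ := GRing.isZmodule.Build (dual_space V)
  dual_addA dual_addC dual_add0 dual_addN.
HB.instance Definition _ := GRing.Zmodule_isLmodule.Build k (dual_space V)
  dual_scaleA dual_scale1 dual_scaleDr dual_scaleDl.

End DualSpace.

(** The dual Sigma-module: E^v(a) = suspension^(a-2) E^*(a) (x) Sgn_a *)

Section DualSmod.
Variable E : smod k.

(** (suspension^(a-2) E^*(a))_e is the dual of E(a)_(a-2-e); here a = m.+1. *)
Definition dual_deg (m : nat) (e : int) : int := m.+1%:Z - 2 - e.

Definition dual_car (m : nat) (e : int) : lmodType k :=
  dual_space (E m (dual_deg m e)).

Lemma dual_act_linear_fun m e (s : 'S_m.+1) (f : dual_car m e) :
  linear (fun x : E m (dual_deg m e) => sgn k s * f (sm_act s^-1%g x) : k^o).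
Proof.
move=> a x y; rewrite sm_act_linear dual_linear mulrDr.
by rewrite /GRing.scale /= mulrCA.
Qed.

Definition dual_act m e (s : 'S_m.+1) (f : dual_car m e) : dual_car m e :=
  DualSpace (dual_act_linear_fun s f).

Lemma dual_act_linear m e s : linear (@dual_act m e s).
Proof. by move=> a f g; apply: dual_ext => x /=; rewrite mulrDr mulrCA. Qed.

Lemma dual_act1 m e (f : dual_car m e) : dual_act 1%g f = f.
Proof.
by apply: dual_ext => x /=; rewrite /sgn odd_perm1 mul1r invg1 sm_act1.
Qed.

Lemma dual_actM m e s t (f : dual_car m e) :
  dual_act t (dual_act s f) = dual_act (t * s)%g f.
Proof.
apply: dual_ext => x /=.
by rewrite sm_actM invMg mulrA /sgn odd_permM signr_addb.
Qed.

Definition dual_smod : smod k :=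
  @Smod k dual_car dual_act dual_act_linear dual_act1 dual_actM.

End DualSmod.

(** The pairing, hence the Koszul dual, is the one of the mathematical text only
    when E(n) is one-dimensional and carries the trivial or the sign action of
    the symmetric group, so that the x o_A y are a basis of the weight 2 part. *)

Section KoszulDual.
Variables (n : nat) (E : smod k).

(** A pairing of F(E^v) and F(E) given on the weight 2 part by
    <a o_A b, x o_B y> = a(x) b(y) if A = B, and 0 otherwise. *)
Record weight2_pairing
    (B : forall m e d, free_operad (dual_smod E) m e -> free_operad E m d -> k) :
    Prop := {
  wp_linl : forall m e d (y : free_operad E m d),
    linear (fun x => B m e d x y : k^o);
  wp_linr : forall m e d (x : free_operad (dual_smod E) m e),
    linear (fun y => B m e d x y : k^o);
  wp_circ : forall (A A' : {set 'I_(n.-1 + n.-1).+1}) e e'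
      (a : dual_smod E n.-1 e) (b : dual_smod E n.-1 e')
      (x : E n.-1 (dual_deg n.-1 e)) (y : E n.-1 (dual_deg n.-1 e')),
    #|A| = n.-1 -> #|A'| = n.-1 ->
    B _ _ _ (circ_at A a b) (circ_at A' x y) =
    if A == A' then a x * b y else 0 }.

(** The annihilator of R in the weight 2 part of F(E^v). The pairing is unique
    on the weight 2 parts. *)
Definition annihilator (R : family (free_operad E)) :
    family (free_operad (dual_smod E)) :=
  fun m e x => weight2 x /\
    exists2 B, weight2_pairing B &
      forall d (y : free_operad E m d), R m d y -> B m e d x y = 0.

End KoszulDual.

Definition koszul_dual n (D : quadratic_data n) : operad k :=
  quadratic_operad (annihilator n (@qd_rels n D)).

Definition koszul_dual_gen n (D : quadratic_data n) m e
    (a : dual_smod (qd_gens D) m e) : koszul_dual D m e :=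
  quadratic_gen (annihilator n (@qd_rels n D)) a.

(** Concentrated in arity n and degree d, where it is one-dimensional, with the
    sign action if [sg] and the trivial action otherwise: the component of arity
    m.+1 and degree e is the space of row vectors of length 1 if m.+1 = n and
    e = d, and of length 0 otherwise. *)
Section OneDim.
Variables (n : nat) (d : int) (sg : bool).

Definition one_dim_car (m : nat) (e : int) : lmodType k :=
  'rV[k]_((m.+1 == n) && (e == d)).

Definition one_dim_act m e (s : 'S_m.+1) (x : one_dim_car m e) :
  one_dim_car m e := (if sg then sgn k s else 1) *: x.

Lemma one_dim_act_linear m e s : linear (@one_dim_act m e s).
Proof. by move=> a x y; rewrite /one_dim_act scalerDr !scalerA mulrC. Qed.

Lemma one_dim_act1 m e (x : one_dim_car m e) : one_dim_act 1%g x = x.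
Proof. by rewrite /one_dim_act /sgn odd_perm1 if_same scale1r. Qed.

Lemma one_dim_actM m e s t (x : one_dim_car m e) :
  one_dim_act t (one_dim_act s x) = one_dim_act (t * s)%g x.
Proof.
rewrite /one_dim_act scalerA /sgn odd_permM signr_addb.
by case: sg => //; rewrite mulr1.
Qed.

Definition one_dim : smod k :=
  @Smod k one_dim_car one_dim_act one_dim_act_linear one_dim_act1 one_dim_actM.

(** The generator (and 0 in the components that vanish). *)
Definition generator m e : one_dim m e :=
  (const_mx 1 : 'rV[k]_((m.+1 == n) && (e == d))).

Lemma one_dim_conc : concentrated_in_arity one_dim n.
Proof.
move=> m e x /eqP/negbTE h; apply/rowP => -[j hj].
by exfalso; move: hj; rewrite h.
Qed.

(** nu o_A nu *)
Definition gen_circ (A : {set 'I_(n.-1 + n.-1).+1}) :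
    free_operad one_dim (n.-1 + n.-1)%N (d + d) :=
  circ_at A (generator n.-1 d) (generator n.-1 d).

Lemma weight2_sub : sub_smod (@weight2 k one_dim).
Proof. exact: sub_generated_sub. Qed.

Lemma gen_circ_weight2 A : weight2 (gen_circ A).
Proof.
apply: (ss_act weight2_sub) => M _; apply; exact: TwoVertices.
Qed.

Lemma weight2_singleton
    (r : free_operad one_dim (n.-1 + n.-1)%N (d + d)) :
  weight2 r -> sub_family (sub_generated (singleton r)) (@weight2 k one_dim).
Proof.
move=> hr m e x; apply=> [|m' e' y]; first exact: weight2_sub.
move=> h; have [em ee] : (m', e') = ((n.-1 + n.-1)%N, d + d) := congr1 tag h.
subst m' e'; suff -> : y = r by [].
exact: shom_inj.
Qed.

Lemma weight2_lin a (x y : free_operad one_dim (n.-1 + n.-1)%N (d + d)) :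
  weight2 x -> weight2 y -> weight2 (a *: x + y).
Proof. exact: (ss_lin weight2_sub). Qed.

Lemma weight2_sum (J : finType) (Q : pred J) (c : J -> k)
    (F : J -> free_operad one_dim (n.-1 + n.-1)%N (d + d)) :
  (forall j, weight2 (F j)) -> weight2 (\sum_(j | Q j) c j *: F j).
Proof.
move=> h; elim/big_rec: _ => [|j x _]; first exact: (ss0 weight2_sub).
by apply: weight2_lin.
Qed.

End OneDim.

Section NLie.
Variables (n : nat) (d : int).

(** v_{n+1, ..., 2n-1} + (-1)^n sum_i v_{{1, ..., n} \ {i}} *)
Definition nLie_relator :
    free_operad (one_dim n d true) (n.-1 + n.-1)%N (d + d) :=
  gen_circ d true (last_block n) +
  (-1) ^+ n *: \sum_(i < n)
    gen_circ d true [set j : 'I_(n.-1 + n.-1).+1 | (j < n)%N && (j != i :> nat)].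

Lemma nLie_relator_weight2 : weight2 nLie_relator.
Proof.
rewrite /nLie_relator -[gen_circ _ _ (last_block n)]scale1r.
apply: weight2_lin; first exact: gen_circ_weight2.
rewrite -[_ *: _]addr0; apply: weight2_lin; last exact: (ss0 (weight2_sub _ _ _)).
under eq_bigr do rewrite -[gen_circ _ _ _]scale1r.
by apply: weight2_sum => i; apply: gen_circ_weight2.
Qed.

Definition nLie_data : quadratic_data n :=
  QuadraticData (@one_dim_conc n d true)
    (sub_generated_sub (singleton nLie_relator))
    (weight2_singleton nLie_relator_weight2).

Definition nLie : operad k := quadratic_operad (@qd_rels n nLie_data).

Definition nLie_nu m e : qd_gens nLie_data m e := generator n d true m e.

End NLie.

Section NCom.
Variables (n : nat) (d : int).

(** The subgroup generated by the transpositions (1, n+1), ..., (n-1, 2n-1). *)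
Definition column_stabilizer : {set 'S_(n.-1 + n.-1).+1} :=
  <<[set tperm (inord i) (inord (n + i)) | i : 'I_n.-1]>>%g.

Definition nCom_relator :
    free_operad (one_dim n d false) (n.-1 + n.-1)%N (d + d) :=
  \sum_(s in column_stabilizer) sgn k s *: gen_circ d false (s @^-1: last_block n).

Lemma nCom_relator_weight2 : weight2 nCom_relator.
Proof. by apply: weight2_sum => s; apply: gen_circ_weight2. Qed.

Definition nCom_data : quadratic_data n :=
  QuadraticData (@one_dim_conc n d false)
    (sub_generated_sub (singleton nCom_relator))
    (weight2_singleton nCom_relator_weight2).

Definition nCom : operad k := quadratic_operad (@qd_rels n nCom_data).

Definition nCom_mu m e : nCom m e :=
  quadratic_gen (@qd_rels n nCom_data) (generator n d false m e).

End NCom.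

End Quadratic.

Arguments nLie_data k n d : clear implicits.
Arguments nLie k n d : clear implicits.
Arguments nCom_data k n d : clear implicits.
Arguments nCom k n d : clear implicits.
Arguments nLie_nu k n d m e : clear implicits.
Arguments nCom_mu k n d m e : clear implicits.

(* Main.v *)
From mathcomp Require Import all_boot all_order all_fingroup all_algebra zify ring.
From mathcomp Require Import boolp.
Require Import Defs.

Set Implicit Arguments.
Unset Strict Implicit.
Unset Printing Implicit Defensive.

Import GRing.Theory.
Local Open Scope ring_scope.

(** Write N = n - 1 and let T be the set of the 2N + 1 inputs.  The proof has an
    operadic half, which reduces the theorem to linear algebra on the functions
    on the N-subsets of T, and a combinatorial half, which identifies an
    eigenspace of the Kneser graph of these subsets with a Specht module.

    Operadic half.  A form on k nu is determined by its value at nu, so the dual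
    generators are identified with those of n-Com, and the free operads on both
    are isomorphic.  By the universal properties of free operads and of
    quotients, the isomorphism descends to the quadratic operads as soon as it
    sends the annihilator of the n-Lie relations into the relations of n-Com
    ([annihilator_nCom]) and its inverse sends the relator of n-Com into the
    annihilator ([nCom_annihilator]).  In weight 2 and arity 2N + 1 the free
    operad is spanned by the elements nu o_A nu ([weight2_combination]), because
    equivariance moves every two-vertex tree to a composite at the first input.
    That these elements are independent, so that the pairing exists at all
    ([pairing_weight2]), is seen by evaluating terms in an operad truncated above
    weight 2 ([jet_cong]); the only delicate point there is that the sign of a
    block permutation is compatible with the signs chosen for the composites
    ([odd_block_perm]).

    Combinatorial half.  In coordinates, orthogonality of y to all translates
    of the n-Lie relator says that y (A) = (-1)^N sum_{b notin A} y (~A - b) for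
    every N-subset A: y is an eigenvector, for the eigenvalue (-1)^N, of the
    graph in which disjoint N-subsets are adjacent.  The translates of the n-Com
    relator are the polytabloids of shape (N + 1, N).  A polytabloid is an
    eigenvector because it changes sign under each column transposition
    ([relator_value_antisym]).  For the converse it suffices, by comparing
    ranks ([kernel_row_span]), that an eigenvector orthogonal to all
    polytabloids vanishes ([polytabloids_separate]).  This is a descent
    ([alternate_vanish]): if all alternating sums of y over m + 1 disjoint pairs
    vanish, then the alternating sums over m pairs do not change when one point
    outside the pairs is exchanged for another, hence are constant, and the
    eigenvector equation reads c = +-(N - m + 1) c with N - m + 1 > 1, so c = 0
    in characteristic 0.  After N steps no pair is left and y = 0. *)

(** * Morphisms of free operads and of quotients *)

Section LinearFunctions.
Variables (k : fieldType) (U V : lmodType k) (f : U -> V).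
Hypothesis hf : linear f.

Lemma lin0 : f 0 = 0.
Proof. by rewrite -(subrr 0) (linearB_of hf) subrr. Qed.

Lemma linD x y : f (x + y) = f x + f y.
Proof. by rewrite -[x in LHS]scale1r hf scale1r. Qed.

Lemma linZ a x : f (a *: x) = a *: f x.
Proof. by rewrite -[_ *: x]addr0 hf lin0 addr0. Qed.

Lemma lin_sum (J : finType) (P : pred J) (F : J -> U) :
  f (\sum_(j | P j) F j) = \sum_(j | P j) f (F j).
Proof. exact: (big_morph f linD lin0). Qed.

End LinearFunctions.

Lemma shom_tag (k : fieldType) (P : smod k) m d m' d' (x : P m d) (y : P m' d') :
  shom x = shom y -> (m, d) = (m', d').
Proof. exact: (congr1 tag). Qed.

Section FreeExtension.
Variables (k : fieldType) (E : smod k) (Q : operad k).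
Variable phi : forall m d, E m d -> Q m d.
Hypothesis phi_lin : forall m d, linear (@phi m d).
Hypothesis phi_act : forall m d s (x : E m d), phi (sm_act s x) = sm_act s (phi x).

Fixpoint term_eval m d (t : term E m d) : Q m d :=
  match t in term _ m d return Q m d with
  | t_gen _ _ x => phi x
  | t_zero _ _ => 0
  | t_add _ _ x y => term_eval x + term_eval y
  | t_scale _ _ a x => a *: term_eval x
  | t_act _ _ s x => sm_act s (term_eval x)
  | t_id => op_id Q
  | t_comp _ _ _ _ i x y => op_comp i (term_eval x) (term_eval y)
  end.

(** Comparing values in the total space makes [eval_rel] meaningful for terms
    whose arities and degrees are only propositionally equal. *)
Definition eval_rel (X Y : {p : nat * int & term E p.1 p.2}) : Prop :=
  shom (term_eval (tagged X)) = shom (term_eval (tagged Y)).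

Lemma eval_relE m d (x y : term E m d) :
  eval_rel (@ohom k (term_ops E) m d x) (@ohom k (term_ops E) m d y) <->
  term_eval x = term_eval y.
Proof. by split=> [/shom_inj|h]; rewrite /eval_rel //= h. Qed.

Lemma eval_cong : @operad_cong k (term_ops E) eval_rel.
Proof.
split.
- move=> [[m d] x] [[m' d'] y]; exact: shom_tag.
- by [].
- by move=> X Y; apply: esym.
- by move=> X Y Z; apply: etrans.
- by move=> m d x x' y y' /eval_relE h /eval_relE h'; apply/eval_relE; rewrite /= h h'.
- by move=> m d a x x' /eval_relE h; apply/eval_relE; rewrite /= h.
- by move=> m d s x x' /eval_relE h; apply/eval_relE; rewrite /= h.
- move=> m n d e i x x' y y' /eval_relE h /eval_relE h'.
  by apply/eval_relE; rewrite /= h h'.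
- by move=> m d x y z; apply/eval_relE; rewrite /= addrA.
- by move=> m d x y; apply/eval_relE; rewrite /= addrC.
- by move=> m d x; apply/eval_relE; rewrite /= add0r.
- by move=> m d x; apply/eval_relE; rewrite /= scale0r.
- by move=> m d x; apply/eval_relE; rewrite /= scale1r.
- by move=> m d a b x; apply/eval_relE; rewrite /= scalerA.
- by move=> m d a x y; apply/eval_relE; rewrite /= scalerDr.
- by move=> m d a b x; apply/eval_relE; rewrite /= scalerDl.
- by move=> m d s a x y; apply/eval_relE; rewrite /= sm_act_linear.
- by move=> m d x; apply/eval_relE; rewrite /= sm_act1.
- by move=> m d s t x; apply/eval_relE; rewrite /= sm_actM.
- move=> m n d e i a x x' y; apply/eval_relE.
  exact: (@op_comp_linl k Q m n d e i (term_eval y)).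
- move=> m n d e i a x y y'; apply/eval_relE.
  exact: (@op_comp_linr k Q m n d e i (term_eval x)).
- by move=> n e x; apply: op_idl.
- by move=> m d i x; apply: op_idr.
- by move=> m n p d e f i j x y z; apply: op_seq.
- by move=> m n p d e f i l x y z; apply: op_par.
- by move=> m n d e i s t x y; apply/eval_relE; apply: op_equiv.
Qed.

Lemma eval_compat : gen_compat eval_rel.
Proof.
split=> [m d a x y|m d s x]; apply/eval_relE => /=.
- exact: phi_lin.
- exact: phi_act.
Qed.

(** Choosing a representative is harmless: [free_extE] gives the value on any
    term of the class. *)
Definition free_ext m d (x : free_operad E m d) : Q m d := term_eval (qrepr x).

Lemma free_extE m d (t : term E m d) :
  free_ext (@quot_pi k (term_ops E) _ (free_cong E) m d t) = term_eval t.
Proof.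
apply/eval_relE; apply: (qrepr_pi (free_cong E) t); [exact: eval_cong|exact: eval_compat].
Qed.

Lemma free_ext_gen m d (x : E m d) : free_ext (gen x) = phi x.
Proof. exact: free_extE. Qed.

Lemma free_ext_morphism : operad_morphism free_ext.
Proof.
split.
- move=> m d a x y; case: (quot_piP x) => t ->; case: (quot_piP y) => u ->.
  by rewrite [X in free_ext X](quot_linE (free_cong E)) !free_extE.
- move=> m d s x; case: (quot_piP x) => t ->.
  by rewrite [X in free_ext X](quot_actE (free_cong E)) !free_extE.
- exact: (free_extE (t_id E)).
- move=> m n d e i x y; case: (quot_piP x) => t ->; case: (quot_piP y) => u ->.
  by rewrite [X in free_ext X](quot_compE (free_cong E)) !free_extE.
Qed.

End FreeExtension.

Section Morphisms.
Variable k : fieldType.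

Section Additivity.
Variables (P Q : operad k) (f : forall m d, P m d -> Q m d).
Hypothesis hf : operad_morphism f.

Lemma om0 m d : f (0 : P m d) = 0.
Proof. exact: (lin0 (@om_linear _ _ _ _ hf m d)). Qed.

Lemma omD m d (x y : P m d) : f (x + y) = f x + f y.
Proof. exact: (linD (@om_linear _ _ _ _ hf m d) x y). Qed.

Lemma omB m d (x y : P m d) : f (x - y) = f x - f y.
Proof. exact: (linearB_of (@om_linear _ _ _ _ hf m d) x y). Qed.

Lemma omZ m d a (x : P m d) : f (a *: x) = a *: f x.
Proof. exact: (linZ (@om_linear _ _ _ _ hf m d) a x). Qed.

Lemma om_sum m d (J : finType) (A : pred J) (F : J -> P m d) :
  f (\sum_(j | A j) F j) = \sum_(j | A j) f (F j).
Proof. exact: (lin_sum (@om_linear _ _ _ _ hf m d) A F). Qed.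

End Additivity.

Lemma morphism_comp (P Q S : operad k) (f : forall m d, P m d -> Q m d)
    (g : forall m d, Q m d -> S m d) :
  operad_morphism f -> operad_morphism g ->
  operad_morphism (fun m d x => g m d (f m d x)).
Proof.
move=> hf hg; split.
- by move=> m d a x y; rewrite (om_linear hf) (om_linear hg).
- by move=> m d s x; rewrite (om_act hf) (om_act hg).
- by rewrite (om_id hf) (om_id hg).
- by move=> m n d e i x y; rewrite (om_comp hf) (om_comp hg).
Qed.

Lemma morphism_id (P : operad k) : operad_morphism (fun m d (x : P m d) => x).
Proof. by split. Qed.

(** Every element is the class of a term, and terms are built from generators
    by the operations that morphisms preserve. *)
Lemma free_morphism_eq (E : smod k) (Q : operad k)
    (f g : forall m d, free_operad E m d -> Q m d) :
  operad_morphism f -> operad_morphism g ->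
  (forall m d (x : E m d), f m d (gen x) = g m d (gen x)) ->
  forall m d (x : free_operad E m d), f m d x = g m d x.
Proof.
move=> hf hg h m d x; case: (quot_piP x) => t ->.
pose pi m d (t : term E m d) : free_operad E m d :=
  @quot_pi k (term_ops E) _ (free_cong E) m d t.
rewrite -/(pi m d t).
elim: t => {m d x} [m d x|m d|m d x hx y hy|m d a x hx|m d s x hx||m n d e i x hx y hy].
- exact: h.
- by rewrite -[pi _ _ _]/(0 : free_operad E m d) (om0 hf) (om0 hg).
- have -> : pi m d (t_add x y) = pi m d x + pi m d y.
    by rewrite -[_ + _]/(qadd _ _) (qpi_add (free_cong E)).
  by rewrite (omD hf) (omD hg) hx hy.
- have -> : pi m d (t_scale a x) = a *: pi m d x by rewrite [RHS]quot_scaleE.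
  by rewrite (omZ hf) (omZ hg) hx.
- have -> : pi m d (t_act s x) = sm_act s (pi m d x).
    by rewrite [RHS](quot_actE (free_cong E)).
  by rewrite (om_act hf) (om_act hg) hx.
- by rewrite -[pi _ _ _]/(op_id (free_operad E)) (om_id hf) (om_id hg).
- have -> : pi _ _ (t_comp i x y) = op_comp i (pi m d x) (pi n e y).
    by rewrite [RHS](quot_compE (free_cong E)).
  by rewrite (om_comp hf) (om_comp hg) hx hy.
Qed.

Section Quotient.
Variables (P : operad k) (I : family P) (HI : operadic_ideal I).

Lemma projP m d (x : operad_quotient HI m d) : exists t, x = operad_proj HI t.
Proof. exact: (quot_piP (HR := ideal_cong HI) x). Qed.

Lemma proj_eq m d (x y : P m d) :
  operad_proj HI x = operad_proj HI y <-> I (x - y).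
Proof.
rewrite -(@ideal_relE k P I m d x y); exact: (quot_pi_eq (ideal_cong HI) x y).
Qed.

Lemma proj_morphism : operad_morphism (fun m d (x : P m d) => operad_proj HI x).
Proof.
split=> //.
- by move=> m d a x y; rewrite [RHS](quot_linE (ideal_cong HI)).
- by move=> m d s x; rewrite [RHS](quot_actE (ideal_cong HI)).
- by move=> m n d e i x y; rewrite [RHS](quot_compE (ideal_cong HI)).
Qed.

Variables (Q : operad k) (h : forall m d, P m d -> Q m d).
Hypothesis hm : operad_morphism h.
Hypothesis hI : forall m d (x : P m d), I x -> h x = 0.

Definition quotient_lift m d (x : operad_quotient HI m d) : Q m d :=
  h (qrepr x).

Lemma quotient_liftE m d (x : P m d) : quotient_lift (operad_proj HI x) = h x.
Proof.
apply/subr0_eq; rewrite -(omB hm); apply: hI.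
by apply/proj_eq; apply: qreprK.
Qed.

Lemma quotient_lift_morphism : operad_morphism quotient_lift.
Proof.
have pm := proj_morphism; split.
- move=> m d a x y; case: (projP x) => t ->; case: (projP y) => u ->.
  by rewrite -(om_linear pm) !quotient_liftE (om_linear hm).
- move=> m d s x; case: (projP x) => t ->.
  by rewrite -(om_act pm) !quotient_liftE (om_act hm).
- by rewrite -(om_id pm) quotient_liftE (om_id hm).
- move=> m n d e i x y; case: (projP x) => t ->; case: (projP y) => u ->.
  by rewrite -(om_comp pm) !quotient_liftE (om_comp hm).
Qed.

End Quotient.

Lemma kernel_ideal (P Q : operad k) (h : forall m d, P m d -> Q m d) :
  operad_morphism h -> operadic_ideal (fun m d (x : P m d) => h m d x = 0).
Proof.
move=> hm; split; first split.
- by move=> m d; rewrite (om0 hm).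
- by move=> m d a x y hx hy; rewrite (om_linear hm) hx hy scaler0 addr0.
- by move=> m d s x hx; rewrite (om_act hm) hx (lin0 (@sm_act_linear _ _ _ _ s)).
- move=> m n d e i x y hx; rewrite (om_comp hm) hx.
  exact: (lin0 (op_comp_linl i _)).
- move=> m n d e i x y hy; rewrite (om_comp hm) hy.
  exact: (lin0 (op_comp_linr i _)).
Qed.

(** The kernel of a morphism is an ideal, so it contains the ideal generated by
    whatever it contains. *)
Lemma ideal_generated_kernel (E : smod k) (R : family (free_operad E)) (Q : operad k)
    (h : forall m d, free_operad E m d -> Q m d) :
  operad_morphism h -> (forall m d x, R m d x -> h m d x = 0) ->
  forall m d x, ideal_generated R x -> h m d x = 0.
Proof. by move=> hm hR m d x /(_ _ (kernel_ideal hm)); apply; exact: hR. Qed.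

End Morphisms.

(** * The sign of a block permutation *)

Lemma odd_perm_val m m' (s : 'S_m) (s' : 'S_m') : m = m' ->
  (forall (a : 'I_m) (a' : 'I_m'), a = a' :> nat -> s a = s' a' :> nat) ->
  odd_perm s = odd_perm s'.
Proof.
move=> e; subst m' => h; congr odd_perm; apply/permP => a; apply: ord_inj.
exact: h.
Qed.

Lemma perm_liftP n (t : 'S_n.+1) (i : 'I_n.+1) :
  exists t' : 'S_n, t = lift_perm i (t i) t'.
Proof.
have hf (j : 'I_n) : exists j', t (lift i j) = lift (t i) j'.
  case: (unliftP (t i) (t (lift i j))) => [j' ->|/perm_inj/eqP]; first by exists j'.
  by rewrite eq_sym (negbTE (neq_lift i j)).
pose f j := projT1 (cid (hf j)); have fE j : t (lift i j) = lift (t i) (f j).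
  by rewrite /f; case: cid.
have f_inj : injective f.
  by move=> j l e; apply: (@lift_inj _ i); apply: (@perm_inj _ t); rewrite !fE e.
exists (perm f_inj); apply/permP => j.
case: (unliftP i j) => [l|] ->; last by rewrite lift_perm_id.
by rewrite lift_perm_lift permE fE.
Qed.

Lemma block_perm_inner m n (i : 'I_m.+1) (s : 'S_m.+1) (t : 'S_n.+1) b :
  block_perm i s t (inner_pos i b) = inner_pos (s i) (t b).
Proof. by rewrite permE block_fun_inner. Qed.

Lemma block_perm_outer m n (i : 'I_m.+1) (s : 'S_m.+1) (t : 'S_n.+1) j : j != i ->
  block_perm i s t (outer_pos n i j) = outer_pos n (s i) (s j).
Proof. by move=> h; rewrite permE block_fun_outer. Qed.

(** Removing one input of the inner operation turns the block permutation into
    the one for a block shorter by one, and t into a permutation of one letter fewer.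
    Both removals change the parity by the sum of the position removed and its
    image, and these sums differ by i + s i. *)
Lemma odd_block_perm m n (i : 'I_m.+1) (s : 'S_m.+1) (t : 'S_n.+1) :
  odd_perm (block_perm i s t) =
  odd_perm s (+) odd_perm t (+) (odd n && odd (i + s i)).
Proof.
elim: n t => [|n IHn] t.
  have -> : t = 1%g by apply/permP => a; rewrite !ord1.
  rewrite odd_perm1 !addbF; apply: odd_perm_val => [|a a' haa]; first by rewrite addn0.
  have [[b ab]|[j hj aj]] := posP i a.
    have -> : a' = i by apply: ord_inj; rewrite -haa ab inner_posE ord1 addn0.
    by rewrite ab block_perm_inner inner_posE ord1 addn0.
  have -> : a' = j.
    by apply: ord_inj; rewrite -haa aj outer_posE addn0 if_same.
  by rewrite aj block_perm_outer // outer_posE addn0 if_same.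
have [t' tE] := perm_liftP t ord0; set c := t ord0 in tE.
have hi := ltn_ord i; have hsi := ltn_ord (s i); have hc := ltn_ord c.
have hp : (i < (m + n).+2)%N by lia.
have hq : (s i + c < (m + n).+2)%N by lia.
have -> : odd_perm (block_perm i s t) =
    odd_perm (lift_perm (Ordinal hp) (Ordinal hq) (block_perm i s t')).
  apply: odd_perm_val => [|a a' haa]; first by rewrite addnS.
  case: (unliftP (Ordinal hp) a') haa => [x|] -> haa; last first.
    have -> : a = inner_pos i ord0 by apply: ord_inj; rewrite haa inner_posE addn0.
    by rewrite block_perm_inner lift_perm_id inner_posE.
  rewrite lift_perm_lift.
  have [[b xb]|[j hj xj]] := posP i x.
    have -> : a = inner_pos i (lift ord0 b).
      by apply: ord_inj; rewrite haa xb /= !inner_posE /= /bump; lia.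
    rewrite block_perm_inner tE lift_perm_lift xb block_perm_inner.
    by rewrite !inner_posE /= inner_posE /bump leq_add2l addnCA.
  have hij : j != i :> nat by [].
  have -> : a = outer_pos n.+1 i j.
    apply: ord_inj; rewrite haa xj /= !outer_posE /bump.
    by case: (ltngtP j i) hij => // hji _; case: leqP; lia.
  rewrite xj !block_perm_outer //= !outer_posE /bump /=.
  have : s j != s i :> nat by rewrite (inj_eq val_inj) (inj_eq perm_inj).
  by case: (ltngtP (s j) (s i)) => // hji _; case: leqP; lia.
rewrite odd_lift_perm IHn [in RHS]tE odd_lift_perm /= !oddD.
by case: (odd i) (odd (s i)) (odd c) (odd_perm s) (odd_perm t') (odd n)
  => [] [] [] [] [] [].
Qed.

(** * Signs and permutations of the natural numbers *)

Section Character.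
Variables (k : fieldType) (sg : bool).

(** The character of the symmetric group by which it acts on the generator:
    the sign or the trivial one, according to [sg]. *)
Definition chi m (s : 'S_m) : k := if sg then sgn k s else 1.

Lemma chi1 m : chi (1%g : 'S_m) = 1.
Proof. by rewrite /chi /sgn odd_perm1 if_same. Qed.

Lemma chiM m (s t : 'S_m) : chi (s * t)%g = chi s * chi t.
Proof. by rewrite /chi; case: sg; rewrite ?mulr1 // /sgn odd_permM signr_addb. Qed.

Lemma chi_even m (s : 'S_m) : ~~ odd_perm s -> chi s = 1.
Proof. by rewrite /chi /sgn => /negbTE ->; rewrite if_same. Qed.

Lemma chi_sqr m (s : 'S_m) : chi s * chi s = 1.
Proof. by rewrite /chi; case: sg; rewrite ?mulr1 // /sgn -signr_addb addbb. Qed.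

Lemma chi_ord1 (s : 'S_1) : chi s = 1.
Proof. by rewrite (_ : s = 1%g) ?chi1 //; apply/permP => a; rewrite !ord1. Qed.

(** The sign of moving a block of n + 1 inputs past i others, when the bracket
    is antisymmetric: (-1)^(i(n+1)) for the inputs and (-1)^i for the bracket. *)
Definition shift_sign (n i : nat) : k := if sg then (-1) ^+ (n * i) else 1.

Lemma shift_sign0l i : shift_sign 0 i = 1.
Proof. by rewrite /shift_sign mul0n if_same. Qed.

Lemma shift_sign0r n : shift_sign n 0 = 1.
Proof. by rewrite /shift_sign muln0 if_same. Qed.

(** This cocycle identity is what makes the coordinates of weight 2 elements
    compatible with equivariance of composition. *)
Lemma chi_block_perm m n (i : 'I_m.+1) (s : 'S_m.+1) (t : 'S_n.+1) :
  chi (block_perm i s t) * shift_sign n (s i) = chi s * chi t * shift_sign n i.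
Proof.
rewrite /chi /shift_sign; case: sg; rewrite ?mulr1 // /sgn odd_block_perm.
rewrite -[(-1) ^+ (n * s i)]signr_odd -[(-1) ^+ (n * i)]signr_odd -!signr_addb.
congr (_ ^+ nat_of_bool _); rewrite !oddM oddD.
by case: (odd n) (odd i) (odd (s i)) (odd_perm s) (odd_perm t) => [] [] [] [] [].
Qed.

End Character.

Section NatPerm.

(** Extending permutations to all of nat gives the weight 2 coordinates of terms
    of all arities a common type, so that they can be compared across the
    equalities between arities in the operad axioms. *)
Definition nat_perm m (s : 'S_m.+1) (j : nat) : nat :=
  if (j < m.+1)%N then s (inord j) : nat else j.

Lemma nat_perm_ord m (s : 'S_m.+1) (a : 'I_m.+1) : nat_perm s a = s a.
Proof. by rewrite /nat_perm ltn_ord inord_val. Qed.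

Lemma nat_permM m (s t : 'S_m.+1) : nat_perm (s * t)%g = nat_perm t \o nat_perm s.
Proof.
apply/funext => j /=; case: (ltnP j m.+1) => h; last first.
  by rewrite /nat_perm (ltnNge j) h /= (ltnNge j) h.
by rewrite -(inordK h) !nat_perm_ord permM.
Qed.

Lemma nat_perm1 m : nat_perm (1%g : 'S_m.+1) = id.
Proof.
apply/funext => j; rewrite /nat_perm; case: ltnP => // h.
by rewrite perm1 inordK.
Qed.

Lemma nat_permK m (s : 'S_m.+1) : cancel (nat_perm s) (nat_perm s^-1%g).
Proof.
by move=> j; rewrite -[LHS]/((nat_perm s^-1%g \o nat_perm s) j) -nat_permM mulgV nat_perm1.
Qed.

Lemma nat_permKV m (s : 'S_m.+1) : cancel (nat_perm s^-1%g) (nat_perm s).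
Proof. by move=> j; have := nat_permK s^-1%g j; rewrite invgK. Qed.

Lemma nat_permV_eq m m' (s : 'S_m.+1) (s' : 'S_m'.+1) :
  nat_perm s = nat_perm s' -> nat_perm s^-1%g = nat_perm s'^-1%g.
Proof.
by move=> e; apply/funext => j; rewrite -{1}[j](nat_permKV s') -e nat_permK.
Qed.

(** The inputs of a composite x o_i y (of arities m + 1 and n + 1) that do not
    come from y, as a predicate on nat. *)
Definition outer_set m n i : nat -> bool :=
  fun a => (a < i)%N || (i + n < a <= m + n)%N.

Lemma nat_perm_block0l n (i : 'I_1) (s : 'S_1) (t : 'S_n.+1) :
  nat_perm (block_perm i s t) = nat_perm t.
Proof.
apply/funext => j; rewrite /nat_perm.
rewrite (_ : (j < (0 + n).+1)%N = (j < n.+1)%N) //; case: ltnP => // h.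
have e : (inord j : 'I_(0 + n).+1) = inner_pos i (inord j : 'I_n.+1).
  by apply: ord_inj; rewrite inner_posE !inordK // ord1.
by rewrite [in LHS]e block_perm_inner inner_posE [s i]ord1 add0n.
Qed.

Lemma nat_perm_block0r m (i : 'I_m.+1) (s : 'S_m.+1) (t : 'S_1) :
  nat_perm (block_perm i s t) = nat_perm s.
Proof.
apply/funext => j; rewrite /nat_perm.
rewrite (_ : (j < (m + 0).+1)%N = (j < m.+1)%N) ?addn0 //; case: ltnP => // h.
have [[b ab]|[l hl al]] := posP i (inord j : 'I_(m + 0).+1).
  rewrite ab block_perm_inner inner_posE ord1 (addn0 (s i)); congr (val (s _)).
  apply: ord_inj; move/(congr1 (@nat_of_ord _)): ab.
  by rewrite inner_posE ord1 (addn0 i) !inordK ?addn0.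
rewrite al block_perm_outer // outer_posE (addn0 (s l)) if_same; congr (val (s _)).
apply: ord_inj; move/(congr1 (@nat_of_ord _)): al.
by rewrite outer_posE (addn0 l) if_same !inordK ?addn0.
Qed.

Lemma outer_set_block m n (i : 'I_m.+1) (s : 'S_m.+1) (t : 'S_n.+1) :
  outer_set m n (s i) \o nat_perm (block_perm i s t) = outer_set m n i.
Proof.
apply/funext => a /=; case: (ltnP a (m + n).+1) => ha; last first.
  rewrite /nat_perm ltnNge ha /= /outer_set.
  by have := ltn_ord i; have := ltn_ord (s i); lia.
rewrite -(inordK ha); move: (inord a) => {ha} {}a; rewrite nat_perm_ord.
have [[b ->]|[l hl ->]] := posP i a.
  rewrite block_perm_inner /outer_set !inner_posE.
  by have := ltn_ord b; have := ltn_ord (t b); lia.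
rewrite block_perm_outer // /outer_set !outer_posE.
have : s l != s i :> nat by rewrite (inj_eq val_inj) (inj_eq perm_inj).
have : l != i :> nat by [].
have := ltn_ord l; have := ltn_ord (s l).
case: (ltngtP l i) => // h1; case: (ltngtP (s l) (s i)) => // h2; lia.
Qed.

Lemma outer_set_blockV m n (i : 'I_m.+1) (s : 'S_m.+1) (t : 'S_n.+1) A :
  (A \o nat_perm (block_perm i s t)^-1%g = outer_set m n (s i)) <->
  (A = outer_set m n i).
Proof.
rewrite -(outer_set_block i s t); split=> [<-|->]; apply/funext => a /=.
- by rewrite nat_permK.
- by rewrite nat_permKV.
Qed.

End NatPerm.

(** * Coordinates on the weight 2 part *)

Section Truncation.
Variables (k : fieldType) (n : nat) (d : int) (sg : bool).
Let E : smod k := one_dim k n d sg.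

(** The components of a term of weight 0, 1 and 2, computed in the operad
    truncated above weight 2.  In weight 2 the coordinate at A is the
    coefficient of the tree whose root carries the inputs in A directly. *)
Fixpoint weight0 m e (t : term E m e) : k :=
  match t with
  | t_gen _ _ _ => 0
  | t_zero _ _ => 0
  | t_add _ _ x y => weight0 x + weight0 y
  | t_scale _ _ a x => a * weight0 x
  | t_act _ _ _ x => weight0 x
  | t_id => 1
  | t_comp _ _ _ _ _ x y => weight0 x * weight0 y
  end.

(** The component has dimension 0 or 1, so the sum is the only entry, or 0. *)
Definition gen_coef m e (x : E m e) : k := \sum_j (x : 'rV[k]_((m.+1 == n) && (e == d))) 0 j.

Fixpoint weight1 m e (t : term E m e) : k :=
  match t with
  | t_gen _ _ x => gen_coef x
  | t_zero _ _ => 0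
  | t_add _ _ x y => weight1 x + weight1 y
  | t_scale _ _ a x => a * weight1 x
  | t_act _ _ s x => chi k sg s * weight1 x
  | t_id => 0
  | t_comp _ _ _ _ _ x y => weight0 x * weight1 y + weight1 x * weight0 y
  end.

Fixpoint weight2_at m e (t : term E m e) (A : nat -> bool) : k :=
  match t with
  | t_gen _ _ _ => 0
  | t_zero _ _ => 0
  | t_add _ _ x y => weight2_at x A + weight2_at y A
  | t_scale _ _ a x => a * weight2_at x A
  | t_act _ _ s x => chi k sg s * weight2_at x (A \o nat_perm s^-1%g)
  | t_id => 0
  | t_comp m n _ _ i x y =>
      weight0 x * weight2_at y A + weight2_at x A * weight0 y +
      weight1 x * weight1 y *
        (shift_sign k sg n i * (`[< A = outer_set m n i >])%:R)
  end.

(** In weight 0 there are only multiples of the identity. *)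
Lemma weight0_support m e (t : term E m e) : weight0 t = 0 \/ m = 0%N /\ e = 0.
Proof.
elim: t => {m e} [m e x|m e|m e x hx y hy|m e a x hx|m e s x hx||m p e f i x hx y hy];
  try by [left|right].
- case: hx => [hx|h]; last by right.
  by case: hy => [hy|h]; [left; rewrite /= hx hy addr0|right].
- by case: hx => [hx|]; [left; rewrite /= hx mulr0|move=> h; right].
- exact: hx.
- case: hx => [hx|[em ee]]; first by left; rewrite /= hx mul0r.
  case: hy => [hy|[ep ef]]; first by left; rewrite /= hy mulr0.
  by right; split; [rewrite em ep|rewrite ee ef].
Qed.

(** The codomain depends on neither arity nor degree, so equality of jets makes
    sense for all pairs of terms. *)
Definition jet (X : {p : nat * int & term E p.1 p.2}) :=
  (tag X, weight0 (tagged X), weight1 (tagged X), weight2_at (tagged X)).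

Definition jet_rel X Y := jet X = jet Y.

Lemma jet_relI m e m' e' (x : term E m e) (y : term E m' e') :
  m = m' -> e = e' -> weight0 x = weight0 y -> weight1 x = weight1 y ->
  (forall A, weight2_at x A = weight2_at y A) ->
  jet_rel (@ohom k (term_ops E) m e x) (@ohom k (term_ops E) m' e' y).
Proof. by move=> hm he h0 h1 /funext h2; rewrite /jet_rel /jet /= h0 h1 h2 hm he. Qed.

Lemma jet_relE m e (x y : term E m e) :
  jet_rel (@ohom k (term_ops E) m e x) (@ohom k (term_ops E) m e y) ->
  [/\ weight0 x = weight0 y, weight1 x = weight1 y
    & forall A, weight2_at x A = weight2_at y A].
Proof. by case=> h0 h1 h2; split=> // A; rewrite h2. Qed.

(** In total weight at most 2, one of x, y, z has to contribute a multiple of the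
    identity, and then the sets and signs on both sides agree. *)
Lemma jet_seq m n' p e f g (i : 'I_m.+1) (j : 'I_n'.+1)
    (x : term E m e) (y : term E n' f) (z : term E p g) :
  jet_rel (@ohom k (term_ops E) _ _ (t_comp (inord (i + j)) (t_comp i x y) z))
          (@ohom k (term_ops E) _ _ (t_comp i x (t_comp j y z))).
Proof.
have hi := ltn_ord i; have hj := ltn_ord j.
have eij : (inord (i + j) : 'I_(m + n').+1) = (i + j)%N :> nat by rewrite inordK //; lia.
apply: jet_relI => /=; [by rewrite addnA|by rewrite addrA|by rewrite mulrA|by ring|].
move=> A; rewrite eij.
set X0 := weight0 x; set Y0 := weight0 y; set Z0 := weight0 z.
set X1 := weight1 x; set Y1 := weight1 y; set Z1 := weight1 z.
have hX : X0 * (shift_sign k sg p (i + j) * (`[< A = outer_set (m + n') p (i + j) >])%:R)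
   = X0 * (shift_sign k sg p j * (`[< A = outer_set n' p j >])%:R).
  have [h0|[em _]] := weight0_support x; first by rewrite /X0 h0 !mul0r.
  have -> : i = 0%N :> nat by lia.
  by rewrite em !add0n.
have hY : Y0 * (shift_sign k sg p (i + j) * (`[< A = outer_set (m + n') p (i + j) >])%:R)
   = Y0 * (shift_sign k sg (n' + p) i * (`[< A = outer_set m (n' + p) i >])%:R).
  have [h0|[em _]] := weight0_support y; first by rewrite /Y0 h0 !mul0r.
  have -> : j = 0%N :> nat by lia.
  by rewrite em !addn0 add0n.
have hZ : Z0 * (shift_sign k sg n' i * (`[< A = outer_set m n' i >])%:R)
   = Z0 * (shift_sign k sg (n' + p) i * (`[< A = outer_set m (n' + p) i >])%:R).
  have [h0|[em _]] := weight0_support z; first by rewrite /Z0 h0 !mul0r.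
  by rewrite em !addn0.
move: (shift_sign k sg p (i + j) * _) (shift_sign k sg p j * _)
  (shift_sign k sg (n' + p) i * _) (shift_sign k sg n' i * _) hX hY hZ => a b c u hX hY hZ.
have -> : (X0 * Y1 + X1 * Y0) * Z1 * a = (X0 * a) * (Y1 * Z1) + (Y0 * a) * (X1 * Z1) by ring.
rewrite hX hY.
have -> : (X0 * weight2_at y A + weight2_at x A * Y0 + X1 * Y1 * u) * Z0
  = (X0 * weight2_at y A + weight2_at x A * Y0) * Z0 + X1 * Y1 * (Z0 * u) by ring.
by rewrite hZ; ring.
Qed.

(** Here x has at least two inputs, so y or z contributes a multiple of the
    identity, of degree 0, and the Koszul sign is 1. *)
Lemma jet_par m n' p e f g (i l : 'I_m.+1)
    (x : term E m e) (y : term E n' f) (z : term E p g) : (i < l)%N ->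
  jet_rel (@ohom k (term_ops E) _ _ (t_comp (inord (l + n')) (t_comp i x y) z))
          (@ohom k (term_ops E) _ _ (t_scale ((-1) ^+ (`|f| * `|g|)%N)
             (t_comp (inord i) (t_comp l x z) y))).
Proof.
move=> il; have hi := ltn_ord i; have hl := ltn_ord l.
have el : (inord (l + n') : 'I_(m + n').+1) = (l + n')%N :> nat by rewrite inordK //; lia.
have ei : (inord i : 'I_(m + p).+1) = i :> nat by rewrite inordK //; lia.
have x0 : weight0 x = 0 by case: (weight0_support x) => // -[em _]; lia.
have sy : (-1) ^+ (`|f| * `|g|)%N * weight0 y = weight0 y :> k.
  have [-> |[_ ed]] := weight0_support y; first by rewrite mulr0.
  have -> : `|f|%N = 0%N by rewrite ed.
  by rewrite mul0n expr0 mul1r.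
have sz : (-1) ^+ (`|f| * `|g|)%N * weight0 z = weight0 z :> k.
  have [-> |[_ ed]] := weight0_support z; first by rewrite mulr0.
  have -> : `|g|%N = 0%N by rewrite ed.
  by rewrite muln0 expr0 mul1r.
apply: jet_relI => /=; rewrite ?x0 ?el ?ei.
- by rewrite addnAC.
- by rewrite addrAC.
- by rewrite !mul0r mulr0.
- rewrite !mul0r !add0r.
  by rewrite mulrCA -[weight1 x * weight0 y]mulrC -[in LHS]sy; ring.
move=> A; rewrite !mul0r !add0r.
have hy : weight0 y * (shift_sign k sg p (l + n') * (`[< A = outer_set (m + n') p (l + n') >])%:R)
   = weight0 y * (shift_sign k sg p l * (`[< A = outer_set m p l >])%:R).
  have [-> |[em _]] := weight0_support y; first by rewrite !mul0r.
  by congr (_ * _); rewrite em !addn0.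
have hz : weight0 z * (shift_sign k sg n' i * (`[< A = outer_set (m + p) n' i >])%:R)
   = weight0 z * (shift_sign k sg n' i * (`[< A = outer_set m n' i >])%:R).
  have [-> |[em _]] := weight0_support z; first by rewrite !mul0r.
  by congr (_ * _); rewrite em !addn0.
move: (shift_sign k sg p (l + n') * _) (shift_sign k sg p l * _)
  (shift_sign k sg n' i * `[< A = outer_set (m + p) n' i >]%:R)
  (shift_sign k sg n' i * (`[< A = outer_set m n' i >])%:R) hy hz sy sz => a b c u hy hz sy sz.
move: ((-1) ^+ _) sy sz => S sy sz.
transitivity (weight2_at x A * weight0 y * weight0 z + weight1 x * weight1 y * (weight0 z * u)
  + weight1 x * weight1 z * (weight0 y * a)); first by ring.
rewrite hy -hz -[in LHS]sy.
transitivity (S * weight0 y * (weight2_at x A * weight0 z + weight1 x * weight1 z * b)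
   + (S * weight0 z) * (weight1 x * weight1 y * c)); last by ring.
by rewrite sz; ring.
Qed.

(** Where x or y contributes a multiple of the identity, the block permutation
    reduces to t or s; otherwise the signs match by [chi_block_perm]. *)
Lemma jet_equiv m n' e f (i : 'I_m.+1) s t (x : term E m e) (y : term E n' f) :
  jet_rel (@ohom k (term_ops E) _ _ (t_comp i (t_act s x) (t_act t y)))
          (@ohom k (term_ops E) _ _ (t_act (block_perm i s t) (t_comp (s i) x y))).
Proof.
have hb := @chi_block_perm k sg m n' i s t.
have hx : weight0 x * chi k sg (block_perm i s t) = weight0 x * chi k sg t.
  have [-> |[em _]] := weight0_support x; first by rewrite !mul0r.
  subst m; move: hb; rewrite !ord1 !shift_sign0r !mulr1 => ->.
  by rewrite [chi k sg s]chi_ord1 mul1r.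
have hy : weight0 y * chi k sg (block_perm i s t) = weight0 y * chi k sg s.
  have [-> |[em _]] := weight0_support y; first by rewrite !mul0r.
  subst n'; move: hb; rewrite !shift_sign0l !mulr1 => ->.
  by rewrite [chi k sg t]chi_ord1 mulr1.
apply: jet_relI => //=.
- rewrite mulrDr mulrCA -[weight0 x * weight1 y]mulrC.
  transitivity (weight0 x * chi k sg t * weight1 y + weight0 y * chi k sg s * weight1 x).
    by ring.
  by rewrite -hx -hy; ring.
move=> A.
have hxA : weight0 x * weight2_at y (A \o nat_perm t^-1%g) =
    weight0 x * weight2_at y (A \o nat_perm (block_perm i s t)^-1%g).
  have [-> |[em _]] := weight0_support x; first by rewrite !mul0r.
  by subst m; rewrite (nat_permV_eq (nat_perm_block0l i s t)).
have hyA : weight0 y * weight2_at x (A \o nat_perm s^-1%g) =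
    weight0 y * weight2_at x (A \o nat_perm (block_perm i s t)^-1%g).
  have [-> |[em _]] := weight0_support y; first by rewrite !mul0r.
  by subst n'; rewrite (nat_permV_eq (nat_perm_block0r i s t)).
have -> : `[< A \o nat_perm (block_perm i s t)^-1%g = outer_set m n' (s i) >] =
   `[< A = outer_set m n' i >].
  by apply: asbool_equiv_eq; apply: outer_set_blockV.
set D := (`[< _ >])%:R.
transitivity (chi k sg t * (weight0 x * weight2_at y (A \o nat_perm t^-1%g)) +
    chi k sg s * (weight0 y * weight2_at x (A \o nat_perm s^-1%g)) +
    weight1 x * weight1 y * D * (chi k sg s * chi k sg t * shift_sign k sg n' i)).
  by ring.
rewrite hxA hyA -hb.
move: (weight2_at y _) (weight2_at x _) => W V.
transitivity ((weight0 x * chi k sg t) * W + (weight0 y * chi k sg s) * V +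
  weight1 x * weight1 y * D * (chi k sg (block_perm i s t) * shift_sign k sg n' (s i))).
  by ring.
by rewrite -hx -hy; ring.
Qed.

(** The truncated evaluation satisfies the operad axioms, so it factors through
    the free operad. *)
Lemma jet_cong : @operad_cong k (term_ops E) jet_rel.
Proof.
split.
- by move=> X Y [].
- by [].
- by move=> X Y; apply: esym.
- by move=> X Y Z; apply: etrans.
- move=> m e x x' y y' /jet_relE[a0 a1 a2] /jet_relE[b0 b1 b2].
  by apply: jet_relI => //= [||A]; congr (_ + _).
- move=> m e a x x' /jet_relE[a0 a1 a2].
  by apply: jet_relI => //= [||A]; congr (_ * _).
- move=> m e s x x' /jet_relE[a0 a1 a2].
  by apply: jet_relI => //= [|A]; congr (_ * _).
- move=> m n' e f i x x' y y' /jet_relE[a0 a1 a2] /jet_relE[b0 b1 b2].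
  by apply: jet_relI => //= [||A]; rewrite ?a0 ?b0 ?a1 ?b1 ?a2 ?b2.
- by move=> m e x y z; apply: jet_relI => //= [||A]; ring.
- by move=> m e x y; apply: jet_relI => //= [||A]; ring.
- by move=> m e x; apply: jet_relI => //= [||A]; ring.
- by move=> m e x; apply: jet_relI => //= [||A]; ring.
- by move=> m e x; apply: jet_relI => //= [||A]; ring.
- by move=> m e a b x; apply: jet_relI => //= [||A]; ring.
- by move=> m e a x y; apply: jet_relI => //= [||A]; ring.
- by move=> m e a b x; apply: jet_relI => //= [||A]; ring.
- by move=> m e s a x y; apply: jet_relI => //= [|A]; ring.
- move=> m e x; apply: jet_relI => //= [|A]; rewrite chi1 ?mul1r //.
  by rewrite invg1 nat_perm1.
- move=> m e s t x; apply: jet_relI => //= [|A]; rewrite chiM mulrA //.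
  by rewrite invMg nat_permM.
- by move=> m n' e f i a x x' y; apply: jet_relI => //= [||A]; ring.
- by move=> m n' e f i a x y y'; apply: jet_relI => //= [||A]; ring.
- move=> m e x; apply: jet_relI => //=; rewrite ?add0r ?mul1r //; first by ring.
  by move=> A; ring.
- move=> m e i x; apply: jet_relI => //=; rewrite ?addn0 ?addr0 ?mulr1 //; first by ring.
  by move=> A; ring.
- exact: jet_seq.
- exact: jet_par.
- exact: jet_equiv.
Qed.

Lemma gen_coef_lin m e a (x y : E m e) :
  gen_coef (a *: x + y) = a * gen_coef x + gen_coef y.
Proof.
rewrite /gen_coef mulr_sumr -big_split /=; apply: eq_bigr => j _.
by rewrite !mxE.
Qed.

Lemma gen_coefZ m e a (x : E m e) : gen_coef (a *: x) = a * gen_coef x.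
Proof. by rewrite /gen_coef mulr_sumr; apply: eq_bigr => j _; rewrite !mxE. Qed.

Lemma jet_compat : gen_compat jet_rel.
Proof.
split=> [m e a x y|m e s x]; apply: jet_relI => //= *; rewrite ?mulr0 ?addr0 //.
- exact: gen_coef_lin.
- exact: gen_coefZ.
Qed.

Definition coord m e (A : nat -> bool) (x : free_operad E m e) : k :=
  weight2_at (qrepr x) A.

Lemma coord_pi m e A (t : term E m e) :
  coord A (@quot_pi k (term_ops E) _ (free_cong E) m e t) = weight2_at t A.
Proof.
have [] := @jet_relE m e (qrepr (@quot_pi k (term_ops E) _ (free_cong E) m e t)) t.
  exact: (qrepr_pi (free_cong E) t _ jet_cong jet_compat).
by move=> _ _; apply.
Qed.

Lemma coord_linear m e A : linear (fun x : free_operad E m e => coord A x : k^o).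
Proof.
move=> a x y; case: (quot_piP x) => t ->; case: (quot_piP y) => u ->.
by rewrite [X in coord A X](quot_linE (free_cong E)) !coord_pi.
Qed.

Lemma coord_act m e A s (x : free_operad E m e) :
  coord A (sm_act s x) = chi k sg s * coord (A \o nat_perm s^-1%g) x.
Proof.
case: (quot_piP x) => t ->.
by rewrite [X in coord A X](quot_actE (free_cong E)) !coord_pi.
Qed.

Lemma coord_comp_gen m m' e e' A (i : 'I_m.+1) (x : E m e) (y : E m' e') :
  coord A (op_comp i (gen x) (gen y)) =
  gen_coef x * gen_coef y * (shift_sign k sg m' i * (`[< A = outer_set m m' i >])%:R).
Proof.
by rewrite [X in coord A X](quot_compE (free_cong E)) !coord_pi /= !mul0r !add0r.
Qed.

End Truncation.

(** * Disjoint pairs of points *)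

Section Pairs.
Variable T : finType.
Implicit Types (l : seq (T * T)) (p : T * T) (A B : {set T}).

Definition swap p : {perm T} := tperm p.1 p.2.

Definition points l : seq T := flatten [seq [:: p.1; p.2] | p <- l].

Definition splits l A := all (fun p => (p.1 \in A) != (p.2 \in A)) l.

Definition selects l A := all (fun p => (p.1 \notin A) && (p.2 \in A)) l.

Definition flip l A := foldr (fun p B => swap p @^-1: B) A l.

Lemma selects_splits l A : selects l A -> splits l A.
Proof. by apply: sub_all => p /andP[/negbTE -> ->]. Qed.

Lemma mem_pointsP l c :
  reflect (exists2 p, p \in l & (c == p.1) || (c == p.2)) (c \in points l).
Proof.
apply: (iffP flattenP) => [[s /mapP[p pl ->]]|[p pl cp]].
  by rewrite !inE; exists p.
by exists [:: p.1; p.2]; [apply: map_f | rewrite !inE].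
Qed.

Lemma mem_points1 l p : p \in l -> p.1 \in points l.
Proof. by move=> pl; apply/mem_pointsP; exists p; rewrite ?eqxx. Qed.

Lemma mem_points2 l p : p \in l -> p.2 \in points l.
Proof. by move=> pl; apply/mem_pointsP; exists p; rewrite ?eqxx ?orbT. Qed.

Lemma card_preim (s : {perm T}) A : #|s @^-1: A| = #|A|.
Proof. exact: card_preimset perm_inj. Qed.

Lemma card_flip l A : #|flip l A| = #|A|.
Proof. by elim: l => //= p l IHl; rewrite card_preim. Qed.

Lemma preim_permM (s t : {perm T}) A : (s * t)%g @^-1: A = s @^-1: (t @^-1: A).
Proof. by apply/setP => c; rewrite !inE permM. Qed.

Lemma swapK p A : swap p @^-1: (swap p @^-1: A) = A.
Proof. by apply/setP => c; rewrite !inE tpermK. Qed.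

Lemma swap_unsplit p A : (p.1 \in A) = (p.2 \in A) -> swap p @^-1: A = A.
Proof. by move=> e; apply/setP => c; rewrite !inE /swap; case: tpermP => [->|->|]. Qed.

(** In a pair with exactly one point in A, exchanging the points has the same
    effect as complementing. *)
Lemma mem_flip l A c : uniq (points l) -> splits l A ->
  (c \in flip l A) = (c \in points l) (+) (c \in A).
Proof.
elim: l c => [|p l IHl] c //= /andP[].
rewrite inE negb_or => /andP[p12 p1l] /andP[p2l ul] /andP[sp sl].
rewrite !inE /swap; case: tpermP => [->|->|/eqP c1 /eqP c2].
- by rewrite IHl // (negbTE p2l) eqxx /=; case: (p.1 \in A) (p.2 \in A) sp => [] [].
- by rewrite IHl // (negbTE p1l) eqxx orbT /=; case: (p.1 \in A) (p.2 \in A) sp => [] [].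
- by rewrite IHl // (negbTE c1) (negbTE c2).
Qed.

Lemma card_points_notin l A : uniq (points l) -> splits l A ->
  #|[pred c | (c \notin A) && (c \in points l)]| = size l.
Proof.
move=> ul sl; transitivity (count [pred c | c \notin A] (points l)).
  rewrite -size_filter -(card_uniqP (filter_uniq _ ul)).
  by apply: eq_card => c; rewrite mem_filter.
elim: l sl {ul} => [|p l IHl] //= /andP[sp /IHl ->].
by case: (p.1 \in A) (p.2 \in A) sp => [] [].
Qed.

Lemma card_outside l A N : #|T| = (N + N).+1 -> #|A| = N -> (size l <= N)%N ->
  uniq (points l) -> splits l A ->
  #|[pred c | (c \notin A) && (c \notin points l)]| = (N - size l).+1.
Proof.
move=> cT cA hl ul sl.
have cC : #|mem (~: A)| = N.+1.
  by have := cardsC A; rewrite cT cA -addnS => /addnI.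
have e1 : #|[predI mem (~: A) & mem (points l)]| = size l.
  by rewrite -(card_points_notin ul sl); apply: eq_card => c; rewrite !inE.
have e2 : #|[predD mem (~: A) & mem (points l)]| =
    #|[pred c | (c \notin A) && (c \notin points l)]|.
  by apply: eq_card => c; rewrite !inE andbC.
by have := cardID (mem (points l)) (mem (~: A)); rewrite e1 e2 cC; lia.
Qed.

Lemma selects_points l A B c : selects l A -> selects l B -> c \in points l ->
  (c \in A) = (c \in B).
Proof.
move=> /allP sA /allP sB /mem_pointsP[p pl].
have /andP[/negbTE a1 a2] := sA p pl; have /andP[/negbTE b1 b2] := sB p pl.
by case/orP => /eqP ->; rewrite ?a1 ?b1 ?a2 ?b2.
Qed.

Lemma selects_eq_points l A B : selects l A ->
  (forall c, c \in points l -> (c \in B) = (c \in A)) -> selects l B.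
Proof.
move=> /allP sA e; apply/allP => p pl; rewrite !e ?sA //.
- exact: mem_points2.
- exact: mem_points1.
Qed.

(** The second points of the pairs already fill a set of size [size l]. *)
Lemma selects_unique l A B : uniq (points l) -> selects l A -> selects l B ->
  #|A| = size l -> #|B| = size l -> A = B.
Proof.
move=> ul.
suff sub X : selects l X -> #|X| = size l -> X \subset points l.
  move=> sA sB /(sub _ sA)/subsetP hA /(sub _ sB)/subsetP hB.
  apply/setP => c; case: (boolP (c \in points l)) => [|/negP cl]; first exact: selects_points.
  by apply/idP/idP => [/hA|/hB].
move=> sX cX.
have sCX : splits l (~: X).
  by apply: sub_all (selects_splits sX) => p; rewrite !inE; case: (_ \in X) (_ \in X) => [] [].
(* The complement of X also splits the pairs, so X meets them in size l points. *)
have e : #|X :&: [set c in points l]| = #|X|.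
  rewrite cX -(card_points_notin ul sCX); apply: eq_card => c.
  by rewrite !inE negbK.
have eX : X :&: [set c in points l] = X by apply/eqP; rewrite eqEcard subsetIl e leqnn.
by apply/subsetP => c; rewrite -eX !inE => /andP[].
Qed.

End Pairs.

(** * Antisymmetric functions on N-subsets *)

Section Antisymmetry.
Variables (k : fieldType) (T : finType).
Hypothesis char0 : [pchar k] =i pred0.
Implicit Types (l : seq (T * T)) (p : T * T) (A B : {set T}) (y : {set T} -> k).

Lemma natr_eq0_char0 m : (m%:R == 0 :> k) = (m == 0%N).
Proof. by move: m; apply/GRing.pcharf0P. Qed.

Lemma eq_opp0 (a : k) : a = - a -> a = 0.
Proof.
move=> /eqP; rewrite -addr_eq0 -mulr2n -mulr_natr mulf_eq0 natr_eq0_char0 orbF.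
by move/eqP.
Qed.

Definition antisym l y := forall p, p \in l -> forall A, y (swap p @^-1: A) = - y A.

(** Exchanging the points of an unsplit pair fixes A, so y A = - y A. *)
Lemma antisym_unsplit l y p A : antisym l y -> p \in l ->
  (p.1 \in A) = (p.2 \in A) -> y A = 0.
Proof. by move=> ay pl /swap_unsplit e; apply: eq_opp0; rewrite -(ay p pl) e. Qed.

Lemma antisym_flip l r y A : antisym l y -> {subset r <= l} ->
  y (flip r A) = (-1) ^+ size r * y A.
Proof.
move=> ay; elim: r => [|p r IHr] sub /=; first by rewrite mul1r.
rewrite ay ?sub ?mem_head // IHr ?exprS ?mulN1r ?mulNr //.
by move=> q qr; apply: sub; rewrite inE qr orbT.
Qed.

Variable N : nat.

(** The pairing of y with the translate of the n-Lie relator attached to A: it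
    vanishes for all A of size N exactly when y is an eigenvector of the Kneser graph
    for the eigenvalue (-1)^N. *)
Definition relator_value y A : k := y A + (-1) ^+ N.+1 * \sum_(b | b \notin A) y (~: A :\ b).

Lemma relator_value_perm (s : {perm T}) y A :
  relator_value (fun B => y (s @^-1: B)) A = relator_value y (s @^-1: A).
Proof.
rewrite /relator_value (reindex_inj (@perm_inj _ s)) /=; congr (_ + _ * _).
apply: eq_big => [b|b _]; rewrite ?inE //; congr y.
by apply/setP => c; rewrite !inE (inj_eq perm_inj).
Qed.

Lemma relator_valueB y z A :
  relator_value (fun B => y B - z B) A = relator_value y A - relator_value z A.
Proof. by rewrite /relator_value sumrB; ring. Qed.

Lemma eq_relator_value y z A : y =1 z -> relator_value y A = relator_value z A.
Proof. by move=> e; rewrite /relator_value e; congr (_ + _ * _); apply: eq_bigr. Qed.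

(** If b lies in a pair, A splits that pair and so ~A - b misses both of its
    points; by antisymmetry its term vanishes. *)
Lemma antisym_sum l y A : antisym l y -> splits l A ->
  \sum_(b | b \notin A) y (~: A :\ b) =
  (-1) ^+ size l * \sum_(b | (b \notin A) && (b \notin points l)) y (flip l (~: A :\ b)).
Proof.
move=> ay /allP sA; rewrite (bigID (mem (points l))) /= big1 ?add0r; last first.
  move=> b /andP[bA /mem_pointsP[p pl bp]]; apply: (antisym_unsplit ay pl).
  have := sA p pl; rewrite !inE.
  case/orP: bp => /eqP ebp; move: bA; rewrite ebp eqxx /=.
    by case: (p.1 \in A); case: (p.2 \in A); rewrite ?andbF.
  by case: (p.1 \in A); case: (p.2 \in A); rewrite ?andbF.
rewrite mulr_sumr; apply: eq_bigr => b _.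
by rewrite (antisym_flip _ ay) // mulrA -expr2 sqrr_sign mul1r.
Qed.

Hypothesis cardT : #|T| = (N + N).+1.

Lemma card_co A b : #|A| = N -> b \notin A -> #|~: A :\ b| = N.
Proof.
move=> cA bA; have := cardsC A; rewrite cardT (cardsD1 b (~: A)) inE bA; lia.
Qed.

Lemma splits_co l A b : splits l A -> b \notin points l -> splits l (~: A :\ b).
Proof.
move=> /allP sA bl; apply/allP => p pl; rewrite !inE.
have -> : p.1 != b by apply: contraNneq bl => <-; apply: mem_points1.
have -> : p.2 != b by apply: contraNneq bl => <-; apply: mem_points2.
by have := sA p pl; case: (p.1 \in A); case: (p.2 \in A).
Qed.

Lemma mem_flip_co l A b c : uniq (points l) -> splits l A -> b \notin points l ->
  c \in points l -> (c \in flip l (~: A :\ b)) = (c \in A).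
Proof.
move=> ul sA bl cl; rewrite mem_flip ?splits_co // cl !inE.
have -> : c != b by apply: contraNneq bl => <-.
by rewrite /= negbK.
Qed.

(** If A leaves a pair unsplit, antisymmetry gives the value 0.  Otherwise
    exactly one point b lies outside A and the pairs, and ~A - b is A with the
    points of all N pairs exchanged: the two terms of the relator cancel. *)
Lemma relator_value_antisym l y A : antisym l y -> uniq (points l) -> size l = N ->
  #|A| = N -> relator_value y A = 0.
Proof.
move=> ay ul sl cA; have [sA|] := boolP (splits l A); last first.
  case/allPn => p pl; rewrite negbK => /eqP e; apply: eq_opp0.
  have {1}-> : relator_value y A = relator_value (fun B => y (swap p @^-1: B)) A.
    by rewrite relator_value_perm swap_unsplit.
  rewrite (eq_relator_value (z := fun B => - y B)) => [|B]; last exact: ay.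
  by rewrite /relator_value sumrN; ring.
have c1 := card_outside cardT cA (eq_leq sl) ul sA; rewrite sl subnn in c1.
rewrite /relator_value (antisym_sum ay sA) sl (eq_bigr (fun=> y A)) => [|b /andP[bA bl]].
  by rewrite sumr_const c1 mulr1n exprS mulN1r mulNr mulrA -expr2 sqrr_sign mul1r subrr.
congr y; apply/eqP; rewrite eqEcard card_flip card_co // cA leqnn andbT.
apply/subsetP => c; have [cl|cl] := boolP (c \in points l); first by rewrite mem_flip_co.
rewrite mem_flip ?splits_co // (negbTE cl) !inE => /andP[cb cA'].
have := cards2 c b; rewrite cb => c2.
have : (#|[set c; b]| <= 1)%N.
  rewrite -c1; apply: subset_leq_card; apply/subsetP => e.
  by rewrite !inE => /orP[] /eqP ->; apply/andP.
by rewrite c2.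
Qed.

(** The alternating sum of y over the 2^|l| sets obtained from A by exchanging
    the points of some of the pairs. *)
Fixpoint alternate l y A : k :=
  if l is p :: l' then alternate l' y A - alternate l' y (swap p @^-1: A) else y A.

Lemma swap_comm p q A : uniq (points [:: p; q]) ->
  swap p @^-1: (swap q @^-1: A) = swap q @^-1: (swap p @^-1: A).
Proof.
rewrite /= !inE !negb_or => /and4P[/and3P[_ p1q1 p1q2] /andP[p2q1 p2q2] _ _].
apply/setP => c; rewrite !inE /swap (inj_tperm p.1 p.2 c (@perm_inj _ (tperm q.1 q.2))).
by rewrite (tpermD (z := p.1)) 1?eq_sym // (tpermD (z := p.2)) 1?eq_sym.
Qed.

Lemma uniq_points_pair l p q : uniq (points (p :: l)) -> q \in l -> uniq (points [:: p; q]).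
Proof.
move=> /= /andP[p1 /andP[p2 ul]] ql.
rewrite inE negb_or in p1; case/andP: p1 => p12 p1.
have q1 := mem_points1 ql; have q2 := mem_points2 ql.
have q12 : q.1 != q.2.
  elim: l ql ul {p1 p2 q1 q2} => //= r l IHl; rewrite inE => /orP[/eqP ->|/IHl IH].
    by rewrite inE negb_or -andbA => /and3P[].
  by move=> /and3P[_ _ /IH].
rewrite /= !inE !negb_or p12 q12 /= !andbT -andbA.
by apply/and4P; split; [apply: contraNneq p1 => ->|apply: contraNneq p1 => ->
  |apply: contraNneq p2 => ->|apply: contraNneq p2 => ->].
Qed.

Lemma alternate_antisym l y : uniq (points l) -> antisym l (alternate l y).
Proof.
elim: l => [|p l IHl] //= /andP[p1 /andP[p2 ul]] q.
rewrite inE => /orP[/eqP ->|ql] A; first by rewrite swapK opprB.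
rewrite (IHl ul q ql) swap_comm; last first.
  by apply: uniq_points_pair ql; rewrite /= p1 p2.
by rewrite (IHl ul q ql) opprB addrC opprK.
Qed.

Lemma alternate_relator_value l y : (forall A, #|A| = N -> relator_value y A = 0) ->
  forall A, #|A| = N -> relator_value (alternate l y) A = 0.
Proof.
move=> ry; elim: l => [|p l IHl] A cA; first exact: ry.
by rewrite /= relator_valueB relator_value_perm !IHl ?card_preim ?subrr.
Qed.

(** Two such sets agree on the pairs, so one is turned into the other by
    exchanging points outside the pairs one at a time. *)
Lemma selects_constant l y :
  (forall A a b, selects l A -> #|A| = N -> a \in A -> a \notin points l ->
     b \notin A -> b \notin points l -> y A = y (tperm b a @^-1: A)) ->
  forall A B, selects l A -> selects l B -> #|A| = N -> #|B| = N -> y A = y B.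
Proof.
move=> hy A B; move em: #|A :\: B| => m; elim: m A em => [|m IHm] A em sA sB cA cB.
  move/eqP: em; rewrite cards_eq0 setD_eq0 => AB; congr y.
  by apply/eqP; rewrite eqEcard AB cA cB leqnn.
have em' : #|B :\: A| = m.+1.
  by have := cardsID A B; have := cardsID B A; rewrite setIC em cA cB; lia.
have [a] : exists a, a \in A :\: B by apply/card_gt0P; rewrite em.
rewrite inE => /andP[aB aA].
have [b] : exists b, b \in B :\: A by apply/card_gt0P; rewrite em'.
rewrite inE => /andP[bA bB].
have al : a \notin points l.
  by apply/negP => /(selects_points sA sB); rewrite aA (negbTE aB).
have bl : b \notin points l.
  by apply/negP => /(selects_points sA sB); rewrite bB (negbTE bA).
rewrite (hy A a b) //; apply: IHm => //; last by rewrite card_preim.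
  have -> : tperm b a @^-1: A :\: B = (A :\: B) :\ a.
    apply/setP => c; rewrite !inE; case: tpermP => [->|->|_ /eqP ->] //.
      by rewrite bB andbF.
    by rewrite (negbTE bA) eqxx andbF.
  by have := cardsD1 a (A :\: B); rewrite em inE aA aB => -[].
apply: (selects_eq_points sA) => c cl; rewrite inE tpermD //.
  by apply: contraNneq bl => ->.
by apply: contraNneq al => ->.
Qed.

(** Adding the pair (b, a) to l expresses that the alternating sum over l takes
    the same value at A and at A with a replaced by b; so it is constant on the
    sets selecting l, and the eigenvector equation becomes
    c (1 +- (m + 2)) = 0, where m + 2 counts the points outside A and the pairs
    when l has N - (m + 1) pairs. *)
Lemma alternate_vanish y : (forall A, #|A| = N -> relator_value y A = 0) ->
  (forall l A, uniq (points l) -> size l = N -> selects l A -> #|A| = N ->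
     alternate l y A = 0) ->
  forall m l A, uniq (points l) -> (size l + m)%N = N -> selects l A -> #|A| = N ->
    alternate l y A = 0.
Proof.
move=> ry hy; elim=> [|m IHm] l A ul sl sA cA; first by rewrite addn0 in sl; apply: hy.
have const := @selects_constant l (alternate l y).
have {}const B : selects l B -> #|B| = N -> alternate l y B = alternate l y A.
  move=> sB cB; apply: const => // {sB cB} {}B a b sB cB aB al bB bl.
  apply/eqP; rewrite -subr_eq0; apply/eqP.
  have := IHm ((b, a) :: l) B; apply=> //=.
  - rewrite inE negb_or bl al ul /= !andbT.
    by apply: contraNneq bB => ->.
  - by rewrite -sl; lia.
  - by rewrite bB aB.
(* All terms of the eigenvector equation for the alternating sum now equal its
   value at A. *)
have := alternate_relator_value l ry cA; have az := alternate_antisym y ul.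
have spA := selects_splits sA.
have lN : (size l <= N)%N by lia.
rewrite /relator_value (antisym_sum az spA).
rewrite (eq_bigr (fun=> alternate l y A)) => [|b /andP[bA bl]].
  rewrite sumr_const (card_outside cardT cA lN ul spA).
  have -> : (N - size l)%N = m.+1 by lia.
  rewrite -mulr_natr mulrA -exprD => e.
  have /eqP : alternate l y A * (1 + (-1) ^+ (N.+1 + size l) * m.+2%:R) = 0.
    by rewrite -[RHS]e; ring.
  rewrite mulf_eq0 => /orP[/eqP //|].
  rewrite -signr_odd; case: (odd _).
    rewrite expr1 mulN1r -[m.+2]addn1 natrD opprD addrCA subrr addr0 oppr_eq0.
    by rewrite natr_eq0_char0.
  by rewrite expr0 mul1r -natr1 natr1 -mulrS natr_eq0_char0.
apply: const; last by rewrite card_flip card_co.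
by apply: (selects_eq_points sA) => c cl; rewrite mem_flip_co.
Qed.

End Antisymmetry.

Section Symmetrizer.
Variables (k : fieldType) (T : finType).
Hypothesis char0 : [pchar k] =i pred0.
Implicit Types (l : seq (T * T)) (p : T * T) (A B : {set T}) (y : {set T} -> k).

(** The column stabilizer, when the pairs are the columns of a tableau. *)
Definition pair_group l : {set {perm T}} := <<[set swap p | p in l]>>%g.
Canonical pair_group_group l := Eval hnf in [group of pair_group l].

Definition antisymmetrize l y A : k :=
  \sum_(s in pair_group l) (-1) ^+ odd_perm s * y (s @^-1: A).

Lemma swap_pair_group l p : p \in l -> swap p \in pair_group l.
Proof. by move=> pl; apply: mem_gen; apply: imset_f. Qed.

Lemma uniq_points_neq l p : uniq (points l) -> p \in l -> p.1 != p.2.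
Proof.
elim: l => //= q l IHl /andP[q1 /andP[_ ul]]; rewrite inE => /orP[/eqP ->|]; last exact: IHl.
by apply: contraNneq q1 => ->; rewrite mem_head.
Qed.

Lemma odd_swapM l p s : uniq (points l) -> p \in l ->
  odd_perm (swap p * s)%g = ~~ odd_perm s.
Proof. by move=> ul pl; rewrite odd_permM odd_tperm (uniq_points_neq ul pl). Qed.

Lemma antisymmetrize_swap l p y A : uniq (points l) -> p \in l ->
  antisymmetrize l (fun B => y (swap p @^-1: B)) A = - antisymmetrize l y A.
Proof.
move=> ul pl; rewrite /antisymmetrize -sumrN [RHS](reindex_inj (mulgI (swap p))) /=.
apply: eq_big => [s|s _]; first by rewrite groupMl // swap_pair_group.
by rewrite (odd_swapM _ ul pl) preim_permM signrN mulNr opprK.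
Qed.

(** Each difference doubles the antisymmetrization.  Comparing with
    [antisym_pair_group], this relates antisymmetrization to the alternating sum
    without enumerating the group. *)
Lemma antisymmetrize_alternate l r y A : uniq (points l) -> {subset r <= l} ->
  antisymmetrize l (alternate r y) A = (2 ^ size r)%:R * antisymmetrize l y A.
Proof.
move=> ul; elim: r => [|p r IHr] sub /=; first by rewrite mul1r.
have subr : {subset r <= l} by move=> q qr; apply: sub; rewrite inE qr orbT.
transitivity (antisymmetrize l (alternate r y) A -
    antisymmetrize l (fun B => alternate r y (swap p @^-1: B)) A).
  by rewrite /antisymmetrize -sumrB; apply: eq_bigr => s _; rewrite mulrBr.
rewrite antisymmetrize_swap ?sub ?mem_head // opprK IHr // expnS natrM.
by ring.
Qed.

Lemma antisym_pair_group l y s A : uniq (points l) -> antisym l y ->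
  s \in pair_group l -> y (s @^-1: A) = (-1) ^+ odd_perm s * y A.
Proof.
move=> ul ay /gen_prodgP[m [c hc ->]].
elim: m c hc A => [|m IHm] c hc A.
  by rewrite big_ord0 odd_perm1 mul1r; congr y; apply/setP => x; rewrite !inE perm1.
rewrite big_ord_recl preim_permM; have /imsetP[p pl ->] := hc ord0.
rewrite ay // (IHm (fun i => c (lift ord0 i))) => [|i]; last exact: hc.
by rewrite (odd_swapM _ ul pl) signrN mulNr.
Qed.

Lemma alternate_eq0 l y A : uniq (points l) -> antisymmetrize l y A = 0 -> alternate l y A = 0.
Proof.
move=> ul s0; have := @antisymmetrize_alternate l l y A ul (fun _ => id); rewrite s0 mulr0.
have az := alternate_antisym y ul.
rewrite /antisymmetrize (eq_bigr (fun=> alternate l y A)) => [|s sG]; last first.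
  by rewrite (antisym_pair_group _ ul az sG) mulrA -expr2 sqrr_sign mul1r.
rewrite sumr_const -mulr_natr => /eqP; rewrite mulf_eq0 natr_eq0_char0 //.
by rewrite eqn0Ngt cardG_gt0 orbF => /eqP.
Qed.

(** The function on sets given by the coordinates of the polytabloid of the
    tableau with columns l and second row L. *)
Definition polytabloid l L A : k := antisymmetrize l (fun B => (A == B)%:R) L.

Lemma polytabloid_antisym l L : uniq (points l) -> antisym l (polytabloid l L).
Proof.
move=> ul p pl A; rewrite /polytabloid -(antisymmetrize_swap _ _ ul pl).
apply: eq_bigr => s _; congr (_ * _%:R); congr nat_of_bool.
by apply/eqP/eqP => [<-|->]; rewrite swapK.
Qed.

Definition move_pairs (s : {perm T}) l := [seq (s p.1, s p.2) | p <- l].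

Lemma alternate_move (s : {perm T}) l y A :
  alternate l (fun B => y (s @^-1: B)) A = alternate (move_pairs s^-1%g l) y (s @^-1: A).
Proof.
elim: l A => //= p l IHl A; rewrite !IHl; congr (_ - alternate _ _ _).
apply/setP => c; rewrite !inE /swap /=.
by rewrite (inj_tperm _ _ _ (@perm_inj _ s)) !permKV.
Qed.

Lemma points_move (s : {perm T}) l : points (move_pairs s l) = map s (points l).
Proof. by elim: l => //= p l <-. Qed.

Lemma points_inj l l' : points l = points l' -> l = l'.
Proof. by elim: l l' => [|[a b] l IHl] [|[a' b'] l'] //= [-> -> /IHl ->]. Qed.

Lemma size_points l : size (points l) = (size l).*2.
Proof. by elim: l => //= p l ->. Qed.

(** Both sequences are completed to enumerations of T. *)
Lemma perm_extend (s t : seq T) : uniq s -> uniq t -> size s = size t ->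
  exists tau : {perm T}, map tau s = t.
Proof.
move=> us ut est.
pose ext u := u ++ [seq c <- enum T | c \notin u].
have uext u : uniq u -> uniq (ext u).
  move=> uu; rewrite cat_uniq uu filter_uniq ?enum_uniq // andbT /=.
  by apply/hasPn => c; rewrite mem_filter => /andP[].
have mext u c : c \in ext u.
  by rewrite mem_cat mem_filter mem_enum andbT orbN.
have sext u : uniq u -> size (ext u) = #|T|.
  by move=> uu; rewrite -(card_uniqP (uext u uu)); apply: eq_card => c; rewrite mext.
case: s us est => [|x0 s] us est.
  by exists 1%g; case: t est {ut}.
set s' := x0 :: s in us est *.
pose f c := nth x0 (ext t) (index c (ext s')).
have f_inj : injective f.
  move=> c c' /eqP; rewrite nth_uniq ?uext //.
  - by move/eqP/(congr1 (nth x0 (ext s'))); rewrite !nth_index ?mext.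
  - by rewrite (sext t ut) -(sext s' us) index_mem mext.
  - by rewrite (sext t ut) -(sext s' us) index_mem mext.
exists (perm f_inj); apply: (@eq_from_nth _ x0); first by rewrite size_map.
rewrite size_map => i hi; rewrite (nth_map x0) // permE /f.
have -> : index (nth x0 s' i) (ext s') = i.
  by rewrite /ext index_cat mem_nth // index_uniq.
by rewrite /ext nth_cat -est hi.
Qed.

(** Any list of N disjoint pairs, with the set of their second points, is moved
    to (l, L) by a permutation, so the hypothesis gives the start of the descent. *)
Theorem polytabloids_separate N l L y : #|T| = (N + N).+1 ->
  uniq (points l) -> size l = N -> selects l L -> #|L| = N ->
  (forall A, #|A| = N -> relator_value N y A = 0) ->
  (forall s : {perm T}, antisymmetrize l (fun B => y (s @^-1: B)) L = 0) ->
  forall A, #|A| = N -> y A = 0.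
Proof.
move=> cT ul sl sL cL ry hs A cA.
apply: (@alternate_vanish k T char0 N cT y ry _ N [::]) => //= {cA A} r A ur sr sA cA.
have [s es] : exists s : {perm T}, map s (points r) = points l.
  by apply: perm_extend => //; rewrite !size_points sl sr.
have er : r = move_pairs s^-1%g l.
  apply: points_inj; rewrite points_move -es -map_comp -[LHS]map_id.
  by apply: eq_map => c /=; rewrite permK.
have -> : A = s @^-1: L.
  apply: (selects_unique ur) => //; rewrite ?card_preim ?sr //.
  rewrite er /selects all_map; apply: sub_all sL => p /=.
  by rewrite !inE !permKV.
by rewrite er -alternate_move; apply: alternate_eq0.
Qed.

End Symmetrizer.

(** * The eigenspace is spanned by polytabloids *)

Section Span.
Variable k : fieldType.

(** The separation hypothesis says that the matrix (M | S^T) has independent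
    rows, so rank S is at least the corank of M, and the row space of S, which
    is contained in the kernel of M, is all of it. *)
Lemma kernel_row_span p m q (S : 'M[k]_(p, m)) (M : 'M[k]_(m, q)) :
  S *m M = 0 -> (forall x : 'rV_m, x *m M = 0 -> x *m S^T = 0 -> x = 0) ->
  forall x : 'rV_m, x *m M = 0 -> (x <= S)%MS.
Proof.
move=> SM sep x xM.
have SK : (S <= kermx M)%MS by apply/sub_kermxP.
have free : \rank (row_mx M S^T) = m.
  apply/eqP; rewrite -[_ == m]/(row_free (row_mx M S^T)) -kermx_eq0.
  apply/rowV0P => v /sub_kermxP; rewrite mul_mx_row -row_mx0 => /eq_row_mx[].
  exact: sep.
have le : (m <= \rank M + \rank S)%N.
  rewrite -{1}free -mxrank_tr tr_row_mx trmxK -addsmxE -(mxrank_tr M).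
  by case: (mxrank_adds_leqif M^T S).
have : (kermx M <= S)%MS.
  by rewrite -(mxrank_leqif_sup SK) eqn_leq mxrankS // mxrank_ker leq_subLR.
by apply: submx_trans; apply/sub_kermxP.
Qed.

Lemma span_of_separation (I J : finType) (M : I -> I -> k) (s : J -> I -> k) :
  (forall j b, \sum_a s j a * M a b = 0) ->
  (forall x : I -> k, (forall b, \sum_a x a * M a b = 0) ->
     (forall j, \sum_a x a * s j a = 0) -> forall a, x a = 0) ->
  forall x : I -> k, (forall b, \sum_a x a * M a b = 0) ->
  exists c : J -> k, forall a, x a = \sum_j c j * s j a.
Proof.
move=> sM sep x xM.
pose Mm : 'M[k]_#|I| := \matrix_(i, j) M (enum_val i) (enum_val j).
pose Sm : 'M[k]_(#|J|, #|I|) := \matrix_(i, j) s (enum_val i) (enum_val j).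
pose vec (z : I -> k) : 'rV[k]_#|I| := \row_i z (enum_val i).
have sumE (F : 'I_#|I| -> k) (G : I -> k) :
    (forall i, F i = G (enum_val i)) -> \sum_i F i = \sum_a G a.
  move=> e; rewrite [RHS](reindex _ (onW_bij _ (@enum_val_bij I))).
  by apply: eq_bigr => i _.
have vecM z : vec z *m Mm = vec (fun b => \sum_a z a * M a b).
  by apply/rowP => j; rewrite !mxE; apply: sumE => i; rewrite !mxE.
have : (vec x <= Sm)%MS.
  apply: (@kernel_row_span _ _ _ _ Mm).
  - apply/matrixP => i j; rewrite !mxE -[RHS](sM (enum_val i) (enum_val j)).
    by apply: sumE => a; rewrite !mxE.
  - move=> v vM vS; pose z a := v 0 (enum_rank a).
    have vz : v = vec z by apply/rowP => i; rewrite mxE /z enum_valK.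
    rewrite vz; apply/rowP => i; rewrite !mxE; apply: sep.
    + move=> b; have /rowP/(_ (enum_rank b)) := vM.
      by rewrite vz vecM !mxE enum_rankK.
    + move=> j; have /rowP/(_ (enum_rank j)) := vS.
      rewrite vz !mxE => e; rewrite -[RHS]e; symmetry; apply: sumE => a.
      by rewrite !mxE enum_rankK.
  - by rewrite vecM; apply/rowP => j; rewrite !mxE.
case/submxP => c e; exists (fun j => c 0 (enum_rank j)) => a.
have := congr1 (fun v : 'rV_#|I| => v 0 (enum_rank a)) e.
rewrite !mxE enum_rankK => ->.
rewrite [RHS](reindex _ (onW_bij _ (@enum_val_bij J))) /=.
by apply: eq_bigr => i _; rewrite !mxE enum_valK enum_rankK.
Qed.

Variable T : finType.
Hypothesis char0 : [pchar k] =i pred0.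
Implicit Types (A B C : {set T}) (y : {set T} -> k).

Lemma sum_delta y B : \sum_A y A * (A == B)%:R = y B.
Proof.
by rewrite (bigD1 B) //= eqxx mulr1 big1 ?addr0 // => A /negbTE ->; rewrite mulr0.
Qed.

Definition moved_polytabloid l L (s : {perm T}) A : k :=
  antisymmetrize l (fun B => (A == s @^-1: B)%:R) L.

Lemma sum_moved_polytabloid l L s y :
  \sum_A y A * moved_polytabloid l L s A = antisymmetrize l (fun B => y (s @^-1: B)) L.
Proof.
rewrite /moved_polytabloid /antisymmetrize.
under eq_bigr do rewrite mulr_sumr.
rewrite exchange_big /=; apply: eq_bigr => t _.
by rewrite -(sum_delta y) mulr_sumr; apply: eq_bigr => A _; rewrite mulrCA.
Qed.

Lemma sum_relator_value N y B :
  \sum_A y A * relator_value N (fun C => (A == C)%:R) B = relator_value N y B.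
Proof.
transitivity (\sum_A (y A * (A == B)%:R +
    (-1) ^+ N.+1 * \sum_(b | b \notin B) y A * (A == ~: B :\ b)%:R)).
  by apply: eq_bigr => A _; rewrite /relator_value mulrDr mulrCA mulr_sumr.
rewrite big_split /= sum_delta -mulr_sumr exchange_big /=; congr (_ + _ * _).
by apply: eq_bigr => b _; rewrite sum_delta.
Qed.

Variables (N : nat) (l : seq (T * T)) (L : {set T}).
Hypothesis (cardT : #|T| = (N + N).+1) (ul : uniq (points l)) (sizel : size l = N).
Hypothesis (selL : selects l L) (cardL : #|L| = N).

Lemma moved_polytabloid_relator_value s A : #|A| = N ->
  relator_value N (moved_polytabloid l L s) A = 0.
Proof.
move=> cA.
have e : moved_polytabloid l L s =1 fun B => polytabloid k l L (s^-1%g @^-1: B).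
  move=> B; apply: eq_bigr => t _; congr (_ * _%:R); congr nat_of_bool.
  apply/eqP/eqP => [->|<-]; apply/setP => c; rewrite !inE ?permKV ?permK //.
rewrite (eq_relator_value _ _ e) relator_value_perm.
apply: (relator_value_antisym char0 cardT _ ul) => //.
  exact: polytabloid_antisym.
by rewrite card_preim.
Qed.

(** The eigenspace is encoded as the kernel of a matrix indexed by all subsets
    of T, which is the identity on subsets of size other than N. *)
Theorem relator_kernel_span y : (forall A, #|A| <> N -> y A = 0) ->
  (forall A, #|A| = N -> relator_value N y A = 0) ->
  exists c : {perm T} -> k, forall A,
    y A = \sum_s c s * moved_polytabloid l L s A.
Proof.
move=> supp ry.
pose M A B : k :=
  if #|B| == N then relator_value N (fun C => (A == C)%:R) B else (A == B)%:R.
have sumM z B : \sum_A z A * M A B = if #|B| == N then relator_value N z B else z B.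
  by rewrite /M; case: ifP => _; [apply: sum_relator_value | apply: sum_delta].
apply: (span_of_separation (M := M)).
- move=> s B; rewrite sumM; case: eqP => cB; first exact: moved_polytabloid_relator_value.
  rewrite /moved_polytabloid /antisymmetrize big1 // => t _.
  by case: eqP => [eB|]; rewrite ?mulr0 //; case: cB; rewrite eB !card_preim.
- move=> z zM zs A; have [cA|cA] := eqVneq #|A| N; last first.
    by have := zM A; rewrite sumM (negbTE cA).
  apply: (polytabloids_separate char0 cardT ul sizel selL cardL) => // [B cB|s].
    by have := zM B; rewrite sumM cB eqxx.
  by rewrite -sum_moved_polytabloid.
- by move=> B; rewrite sumM; case: eqP => [/ry|/supp].
Qed.

End Span.

(** * Two-vertex composites in an operad *)

Section LastBlock.
Variable N : nat.
Local Notation T := 'I_(N + N).+1.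
Local Notation L := (last_block N.+1 : {set T}).

Lemma in_last_block (a : T) : (a \in L) = (N < a)%N.
Proof. by rewrite inE. Qed.

Lemma preim_perm1 (A : {set T}) : (1%g : {perm T}) @^-1: A = A.
Proof. by apply/setP => a; rewrite !inE perm1. Qed.

(** The factors t and s are the restrictions of b to the first N + 1 inputs and to
    the last block. *)
Lemma block_perm_of_stable (b : 'S_(N + N).+1) : b @^-1: L = L ->
  exists s t : 'S_N.+1, s ord0 = ord0 /\ b = @block_perm N N ord0 s t.
Proof.
move=> /setP hb; have {}hb (a : T) : (N < b a)%N = (N < a)%N.
  by have := hb a; rewrite inE !in_last_block.
have inner (c : 'I_N.+1) : @inner_pos N N ord0 c = c :> nat by rewrite inner_posE.
have outer (j : 'I_N.+1) : j != ord0 -> @outer_pos N N ord0 j = (j + N)%N :> nat.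
  by move=> _; rewrite outer_posE.
have bin (c : 'I_N.+1) : (b (@inner_pos N N ord0 c) < N.+1)%N.
  by rewrite ltnS leqNgt hb inner -leqNgt -ltnS.
have bout (j : 'I_N.+1) : j != ord0 -> (N < b (@outer_pos N N ord0 j))%N.
  by move=> hj; rewrite hb outer // -[X in (X < _)%N]add0n ltn_add2r lt0n.
pose tf (c : 'I_N.+1) : 'I_N.+1 := inord (b (@inner_pos N N ord0 c)).
pose sf (j : 'I_N.+1) : 'I_N.+1 :=
  if j == ord0 then ord0 else inord (b (@outer_pos N N ord0 j) - N).
have tfE c : tf c = b (@inner_pos N N ord0 c) :> nat by rewrite inordK.
have sfE j : j != ord0 -> (sf j + N)%N = b (@outer_pos N N ord0 j) :> nat.
  move=> hj; rewrite /sf (negbTE hj); have := bout j hj.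
  by have := ltn_ord (b (@outer_pos N N ord0 j)); rewrite ltnS => h1 h2; rewrite inordK; lia.
have sf0 j : (sf j == ord0) = (j == ord0).
  apply/idP/idP => [|/eqP ->]; last by rewrite /sf eqxx.
  apply: contraTT => hj; have := bout j hj; rewrite -sfE // => h.
  by rewrite -val_eqE /=; lia.
have tf_inj : injective tf.
  move=> c c' /(congr1 val) /=; rewrite !tfE => /val_inj/perm_inj/(congr1 val) /=.
  by rewrite !inner => /val_inj.
have sf_inj : injective sf.
  move=> j j' e; case: (eqVneq j ord0) => [ej|hj].
    by apply/eqP; rewrite ej eq_sym -sf0 -e sf0 ej.
  have hj' : j' != ord0 by rewrite -sf0 -e sf0.
  have : b (@outer_pos N N ord0 j) = b (@outer_pos N N ord0 j').
    by apply: val_inj; rewrite /= -!sfE // e.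
  move/perm_inj/(congr1 val) => /=; rewrite !outer // => /eqP.
  by rewrite eqn_add2r => /eqP/val_inj.
have s0 : perm sf_inj ord0 = ord0 by rewrite permE; apply/eqP; rewrite sf0.
exists (perm sf_inj), (perm tf_inj); split=> //.
apply/permP => a; apply: val_inj => /=.
have [[c ->]|[j hj ->]] := posP ord0 a.
  by rewrite block_perm_inner s0 permE inner tfE.
by rewrite block_perm_outer // s0 permE outer ?sf0 // sfE.
Qed.

Hypothesis N_gt0 : (0 < N)%N.

Lemma card_last_block : #|L| = N.
Proof.
have -> : L = [set rshift N.+1 i | i : 'I_N].
  apply/setP => a; rewrite in_last_block; apply/idP/imsetP => [ha|[i _ ->]] /=; last by lia.
  have h : (a - N.+1 < N)%N by have := ltn_ord a; lia.
  by exists (Ordinal h) => //; apply: val_inj => /=; lia.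
by rewrite card_imset ?card_ord //; exact: (@rshift_inj N.+1 N).
Qed.

(** At least two inputs lie outside the last block; a transposition of two of
    them corrects the parity. *)
Lemma even_perm_atP (A : {set T}) : #|A| = N ->
  ~~ odd_perm (@even_perm_at N.+1 A) /\ (@even_perm_at N.+1 A) @^-1: L = A.
Proof.
move=> cA; suff [s /andP[os /eqP es]] : exists s : 'S_(N + N).+1,
    ~~ odd_perm s && (s @^-1: L == A).
  rewrite /even_perm_at; case: pickP => [t /andP[ot /eqP et] //|/(_ s)].
  by rewrite /= os es eqxx.
have [t et] : exists t : {perm T}, map t (enum A) = enum L.
  by apply: perm_extend; rewrite ?enum_uniq // -!cardE card_last_block.
have tA : t @^-1: L = A.
  apply/setP => a; rewrite inE -(mem_enum L) -et mem_map ?mem_enum //.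
  exact: perm_inj.
have h1 : (1 < (N + N).+1)%N by lia.
pose q : 'S_(N + N).+1 := tperm ord0 (Ordinal h1).
have qL : q @^-1: L = L.
  apply/setP => a; rewrite inE; case: tpermP => [->|->|] //; rewrite !in_last_block /=; lia.
have oq : odd_perm q by rewrite odd_tperm.
have [ot|ot] := boolP (odd_perm t); last by exists t; rewrite ot tA eqxx.
by exists (t * q)%g; rewrite odd_permM ot oq preim_permM qL tA eqxx.
Qed.

Section Circ.
Variables (k : fieldType) (sg : bool) (Q : operad k) (e : int) (x : Q N e).
Hypothesis act_x : forall s, sm_act s x = chi k sg s *: x.

Definition circ (A : {set T}) : Q (N + N)%N (e + e) :=
  sm_act (@even_perm_at N.+1 A) (op_comp ord0 x x).

Lemma act_stable (b : 'S_(N + N).+1) : b @^-1: L = L ->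
  sm_act b (op_comp ord0 x x) = chi k sg b *: op_comp ord0 x x.
Proof.
move=> /block_perm_of_stable[s [t [s0 ->]]].
have := op_equiv ord0 s t x x; rewrite s0 => <-; rewrite !act_x.
rewrite (linZ (@op_comp_linl k Q _ _ _ _ ord0 _)) (linZ (@op_comp_linr k Q _ _ _ _ ord0 _)).
rewrite scalerA; congr (_ *: _).
by have := chi_block_perm k sg ord0 s t; rewrite s0 shift_sign0r !mulr1.
Qed.

(** Two permutations with the same preimage of the last block differ by one that
    preserves this block, which acts by its character ([act_stable]). *)
Lemma act_comp (b : 'S_(N + N).+1) :
  sm_act b (op_comp ord0 x x) = chi k sg b *: circ (b @^-1: L).
Proof.
have cA : #|b @^-1: L| = N by rewrite card_preim card_last_block.
have [oe ee] := even_perm_atP cA; rewrite /circ; set t := even_perm_at _ in oe ee *.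
have er : (t * (t^-1 * b))%g = b by rewrite mulKVg.
have sr : (t^-1 * b)%g @^-1: L = L.
  by rewrite preim_permM -ee; apply/setP => a; rewrite !inE permKV.
rewrite -[in LHS]er -sm_actM act_stable // (linZ (@sm_act_linear _ _ _ _ t)).
by congr (_ *: _); rewrite -[in RHS]er [in RHS]chiM (chi_even k sg oe) mul1r.
Qed.

Lemma act_circ (b : 'S_(N + N).+1) (A : {set T}) : #|A| = N ->
  sm_act b (circ A) = chi k sg b *: circ (b @^-1: A).
Proof.
move=> /even_perm_atP[oe ee].
by rewrite {1}/circ sm_actM act_comp chiM (chi_even k sg oe) mulr1 preim_permM ee.
Qed.

(** Equivariance under the transposition of i and 0 reduces composition at any
    input to composition at the first one. *)
Lemma comp_circ (i : 'I_N.+1) : exists2 A : {set T}, #|A| = N &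
  exists a, op_comp i x x = a *: circ A.
Proof.
pose s : 'S_N.+1 := tperm i ord0.
exists (@block_perm N N i s 1%g @^-1: L); first by rewrite card_preim card_last_block.
exists (chi k sg s * chi k sg (@block_perm N N i s 1%g)).
have := op_equiv i s 1%g x x; rewrite tpermL act_comp sm_act1 act_x.
rewrite (linZ (@op_comp_linl k Q _ _ _ _ i _)) => h.
by rewrite -scalerA -h scalerA chi_sqr scale1r.
Qed.

End Circ.
End LastBlock.

(** * The weight 2 part of a free operad on one generator *)

Lemma ord_bool_eq (b : bool) (i j : 'I_b) : i = j.
Proof. by apply: val_inj; case: b i j => -[i hi] [j hj] /=; lia. Qed.

Section Generators.
Variables (k : fieldType).

Lemma gen_linear (E : smod k) m e : linear (@gen k E m e).
Proof.
move=> a x y; rewrite (quot_linE (free_cong E)).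
by apply/(quot_pi_eq (free_cong E)) => R HR [gl ga]; apply: gl.
Qed.

Lemma gen_act (E : smod k) m e s (x : E m e) : gen (sm_act s x) = sm_act s (gen x).
Proof.
rewrite [RHS](quot_actE (free_cong E)).
by apply/(quot_pi_eq (free_cong E)) => R HR [gl ga]; apply: ga.
Qed.

Variables (n : nat) (d : int) (sg : bool).
Local Notation E := (one_dim k n d sg).

Lemma gen_coef_generator m e :
  gen_coef (generator k n d sg m e) = ((m.+1 == n) && (e == d))%:R.
Proof.
rewrite /gen_coef; under eq_bigr do rewrite mxE.
by rewrite sumr_const card_ord.
Qed.

Lemma gen_coefE m e (x : E m e) : x = gen_coef x *: generator k n d sg m e.
Proof.
apply/rowP => j; rewrite !mxE mulr1 /gen_coef (bigD1 j) //= big1 ?addr0 // => i.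
by rewrite (ord_bool_eq i j) eqxx.
Qed.

Lemma act_generator m e s :
  sm_act s (gen (generator k n d sg m e)) = chi k sg s *: gen (generator k n d sg m e).
Proof. by rewrite -gen_act -(linZ (@gen_linear E m e)). Qed.

End Generators.

Section WeightTwo.
Variables (k : fieldType) (N : nat) (d : int) (sg : bool).
Hypothesis N_gt0 : (0 < N)%N.
Local Notation T := 'I_(N + N).+1.
Local Notation L := (last_block N.+1 : {set T}).
Local Notation E := (one_dim k N.+1 d sg).
Local Notation gcirc := (@gen_circ k N.+1 d sg).

Lemma act_gen_circ (b : 'S_(N + N).+1) (A : {set T}) : #|A| = N ->
  sm_act b (gcirc A) = chi k sg b *: gcirc (b @^-1: A).
Proof. by move=> cA; apply: (act_circ N_gt0 (@act_generator k N.+1 d sg N d) b cA). Qed.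

Definition combination (c : {set T} -> k) : free_operad E (N + N)%N (d + d) :=
  \sum_(A : {set T} | #|A| == N) c A *: gcirc A.

Lemma combination_lin a c c' :
  a *: combination c + combination c' = combination (fun A => a * c A + c' A).
Proof.
rewrite /combination scaler_sumr -big_split; apply: eq_bigr => A _.
by rewrite scalerA scalerDl.
Qed.

Lemma combination_delta (B : {set T}) a : #|B| = N ->
  combination (fun A => a * (A == B)%:R) = a *: gcirc B.
Proof.
move=> /eqP cB; rewrite /combination (bigD1 B) //= eqxx mulr1 big1 ?addr0 //.
by move=> A /andP[_ /negbTE ->]; rewrite mulr0 scale0r.
Qed.

Lemma combination_act b c : exists c', sm_act b (combination c) = combination c'.
Proof.
exists (fun A : {set T} => chi k sg b * c (b^-1%g @^-1: A)).
rewrite /combination (lin_sum (@sm_act_linear _ _ _ _ b)).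
have inj : injective (fun A : {set T} => b @^-1: A).
  move=> A B e; rewrite -(preim_perm1 A) -(preim_perm1 B) -(mulVg b).
  by rewrite !preim_permM e.
rewrite [RHS](reindex_inj inj); apply: eq_big => A; first by rewrite card_preim.
move=> /eqP cA; rewrite (linZ (@sm_act_linear _ _ _ _ b)) act_gen_circ // scalerA.
by rewrite mulrC -preim_permM mulVg preim_perm1.
Qed.

(** Outside arity N + 1 and degree d the generators vanish, so two-vertex elements
    only exist in arity 2N + 1 and degree 2d. *)
Lemma weight2_combination m e (x : free_operad E m e) : weight2 x ->
  ((m, e) = ((N + N)%N, d + d) -> exists c, shom x = shom (combination c)) /\
  ((m, e) <> ((N + N)%N, d + d) -> x = 0).
Proof.
pose K : family (free_operad E) := fun m e x =>
  ((m, e) = ((N + N)%N, d + d) -> exists c, shom x = shom (combination c)) /\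
  ((m, e) <> ((N + N)%N, d + d) -> x = 0).
have K0 m' e' : K m' e' 0.
  split=> // -[-> ->]; exists (fun=> 0).
  by rewrite /combination big1 // => A _; rewrite scale0r.
move=> /(_ K) hK; apply: hK; first split.
- exact: K0.
- move=> m' e' a y z [hy hy'] [hz hz']; split=> h; last first.
    by rewrite hy' // hz' // scaler0 addr0.
  have [c hc] := hy h; have [c' hc'] := hz h; move: h => [em ee]; subst m' e'.
  rewrite (shom_inj hc) (shom_inj hc') combination_lin.
  by eexists; reflexivity.
- move=> m' e' s y [hy hy']; split=> h; last by rewrite hy' // (lin0 (@sm_act_linear _ _ _ _ s)).
  have [c hc] := hy h; move: h => [em ee]; subst m' e'.
  by rewrite (shom_inj hc); have [c' ->] := combination_act s c; exists c'.
move=> m' e' _ [m1 m2 e1 e2 i y z].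
have z0 m3 e3 (u : E m3 e3) : (m3.+1 == N.+1) && (e3 == d) = false -> gen u = 0.
  move=> h; rewrite (gen_coefE u) (linZ (@gen_linear k E _ _)).
  suff -> : gen_coef u = 0 by rewrite scale0r.
  by rewrite (gen_coefE u) gen_coefZ gen_coef_generator h mulr0.
case h1: ((m1.+1 == N.+1) && (e1 == d)); last first.
  by rewrite z0 // (lin0 (op_comp_linl i _)); apply: K0.
case h2: ((m2.+1 == N.+1) && (e2 == d)); last first.
  by rewrite (z0 _ _ z) // (lin0 (op_comp_linr i _)); apply: K0.
move/andP: h1 => [/eqP[em1] /eqP ee1]; move/andP: h2 => [/eqP[em2] /eqP ee2].
subst m1 m2 e1 e2; split=> // _.
have [A cA [a ea]] := comp_circ N_gt0 (@act_generator k N.+1 d sg N d) i.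
exists (fun B => (gen_coef y * gen_coef z * a) * (B == A)%:R); congr shom.
rewrite combination_delta // {1}(gen_coefE y) {1}(gen_coefE z).
rewrite !(linZ (@gen_linear k E _ _)).
rewrite (linZ (op_comp_linl i _)) (linZ (op_comp_linr i _)) ea.
by rewrite !scalerA.
Qed.

Definition nat_set (A : {set T}) : nat -> bool :=
  fun j => (j < (N + N).+1)%N && (inord j \in A).

Lemma nat_set_preim (s : {perm T}) (A : {set T}) : nat_set (s @^-1: A) = nat_set A \o nat_perm s.
Proof.
apply/funext => j; rewrite /nat_set /nat_perm /= inE.
by case: ltnP => h; rewrite ?ltn_ord ?inord_val // ltnNge h.
Qed.

Lemma nat_set_inj : injective nat_set.
Proof.
move=> A B e; apply/setP => a; have := congr1 (@^~ (a : nat)) e.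
by rewrite /nat_set ltn_ord inord_val.
Qed.

Lemma nat_set_last_block : nat_set L = outer_set N N 0.
Proof.
apply/funext => j; rewrite /nat_set /outer_set /=.
by case: ltnP => h; [rewrite in_last_block inordK //=; lia | lia].
Qed.

Lemma coord_circ_at (A B : {set T}) e e' (x : E N e) (y : E N e') : #|A| = N ->
  coord (nat_set B) (@circ_at k N.+1 E A e e' x y) =
  gen_coef x * gen_coef y * (A == B)%:R.
Proof.
move=> /(even_perm_atP N_gt0); rewrite /circ_at.
move: (@even_perm_at N.+1 A) => s [oe ee].
rewrite coord_act coord_comp_gen (chi_even k sg oe) mul1r shift_sign0r mul1r.
rewrite -nat_set_preim -nat_set_last_block; congr (_ * _%:R); congr nat_of_bool.
apply/asboolP/eqP => [/nat_set_inj e1|<-].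
  by rewrite -ee -e1 -preim_permM mulgV preim_perm1.
by rewrite -ee -preim_permM mulVg preim_perm1.
Qed.

End WeightTwo.

(** * Duality of the generators and the pairing *)

Lemma weight2_ext (k : fieldType) (E E' : smod k) (u : forall m e, E m e -> E' m e)
    (h : forall m e, free_operad E m e -> free_operad E' m e) :
  operad_morphism h -> (forall m e (x : E m e), h m e (gen x) = gen (u m e x)) ->
  forall m e (x : free_operad E m e), weight2 x -> weight2 (h m e x).
Proof.
move=> hm hg m e x /(_ (fun m e x => weight2 (h m e x))) hx; apply: hx.
  have w2 : sub_smod (@weight2 k E') by exact: sub_generated_sub.
  split.
  - by move=> m' e'; rewrite (om0 hm); apply: (ss0 w2).
  - by move=> m' e' a y z hy hz; rewrite (om_linear hm); apply: (ss_lin w2).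
  - by move=> m' e' s y hy; rewrite (om_act hm); apply: (ss_act w2).
move=> m' e' _ [m1 m2 e1 e2 i y z] M _; apply.
by rewrite (om_comp hm) !hg; apply: TwoVertices.
Qed.

Section Columns.
Variable N : nat.
Hypothesis N_gt0 : (0 < N)%N.
Local Notation T := 'I_(N + N).+1.
Local Notation L := (last_block N.+1 : {set T}).

Definition columns : seq (T * T) :=
  [seq (inord i, inord (N.+1 + i)) | i : 'I_N <- enum 'I_N].

Lemma size_columns : size columns = N.
Proof. by rewrite size_map size_enum_ord. Qed.

Lemma uniq_columns : uniq (points columns).
Proof.
rewrite /columns; have := enum_uniq 'I_N; elim: (enum 'I_N) => //= i s IHs /andP[iNs us].
have hi := ltn_ord i.
have inE' a b : (a < (N + N).+1)%N -> (b < (N + N).+1)%N ->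
    ((inord a : T) == inord b) = (a == b).
  by move=> ha hb; rewrite -val_eqE /= !inordK.
rewrite IHs // andbT inE negb_or inE' ?andbA; try lia.
apply/andP; split; [apply/andP; split; first lia|];
  apply/mem_pointsP => -[_ /mapP[j js ->]] /=; have hj := ltn_ord j;
  rewrite !inE'; try lia; move=> e; have : i == j by rewrite -val_eqE /=; lia.
- by move/eqP => ij; rewrite ij js in iNs.
- by move/eqP => ij; rewrite ij js in iNs.
Qed.

Lemma selects_columns : selects columns L.
Proof.
apply/allP => _ /mapP[i _ ->] /=; have hi := ltn_ord i.
by rewrite !in_last_block !inordK; lia.
Qed.

Lemma column_stabilizerE : column_stabilizer N.+1 = pair_group columns.
Proof.
congr (<<_>>)%g; apply/setP => s; apply/imsetP/imsetP => [[i _ ->]|[_ /mapP[i _ ->] ->]].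
  exists (inord i, inord (N.+1 + i)) => //.
  by apply/mapP; exists i; rewrite ?mem_enum.
by exists i.
Qed.

Lemma sum_not_last (V : nmodType) (F : T -> V) :
  \sum_(b | b \notin L) F b = \sum_(i < N.+1) F (inord i).
Proof.
rewrite (reindex_onto (fun i : 'I_N.+1 => inord i : T) (fun b : T => inord b)) /=.
  apply: eq_bigl => i; have hi := ltn_ord i.
  rewrite in_last_block inordK; last by lia.
  by rewrite inord_val eqxx andbT; lia.
move=> b; rewrite in_last_block -leqNgt => hb; apply: val_inj.
by rewrite /= inordK inordK //; have := ltn_ord b; lia.
Qed.

Lemma relator_value_last_block (k : fieldType) (y : {set T} -> k) :
  relator_value N y L = y L + (-1) ^+ N.+1 * \sum_(i < N.+1)
    y [set j : T | (j < N.+1)%N && (j != i :> nat)].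
Proof.
rewrite /relator_value sum_not_last; congr (_ + _ * _); apply: eq_bigr => i _; congr y.
have hi := ltn_ord i.
apply/setP => j; rewrite !inE -leqNgt ltnS -val_eqE /= inordK; last by lia.
by rewrite andbC.
Qed.

Lemma card_not_last (i : 'I_N.+1) :
  #|[set j : T | (j < N.+1)%N && (j != i :> nat)]| = N.
Proof.
have hi := ltn_ord i.
have -> : [set j : T | (j < N.+1)%N && (j != i :> nat)] = ~: L :\ inord i.
  apply/setP => j; rewrite !inE -leqNgt ltnS -val_eqE /= inordK; last by lia.
  by rewrite andbC.
apply: card_co; rewrite ?card_ord ?card_last_block //.
by rewrite in_last_block inordK; lia.
Qed.

End Columns.

Section Duality.
Variables (k : fieldType) (N : nat) (d : int).
Hypothesis N_gt0 : (0 < N)%N.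
Local Notation T := 'I_(N + N).+1.
Let e0 : int := - d + N.+1%:Z - 2.
Local Notation E := (one_dim k N.+1 d true).
Local Notation H := (one_dim k N.+1 e0 false).
Local Notation Ev := (dual_smod E).
Local Notation nu := (generator k N.+1 d true).
Local Notation mu := (generator k N.+1 e0 false).

Lemma dual_deg_eq m e :
  ((m.+1 == N.+1) && (dual_deg m e == d)) = ((m.+1 == N.+1) && (e == e0)).
Proof.
case: eqP => //= em; rewrite /dual_deg em /e0.
by apply/eqP/eqP; lia.
Qed.

Definition com_of_dual m e (a : Ev m e) : H m e := a (nu m (dual_deg m e)) *: mu m e.

Lemma dual_of_com_form_linear m e (h : H m e) :
  linear (fun v : E m (dual_deg m e) => gen_coef h * gen_coef v : k^o).
Proof.
move=> a x y; rewrite gen_coef_lin mulrDr mulrCA; congr (_ + _).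
Qed.

Definition dual_of_com m e (h : H m e) : Ev m e := DualSpace (dual_of_com_form_linear h).

Lemma com_of_dual_linear m e : linear (@com_of_dual m e).
Proof. by move=> a x y; rewrite /com_of_dual /= scalerDl scalerA. Qed.

Lemma com_of_dual_act m e s (a : Ev m e) :
  com_of_dual (sm_act s a) = sm_act s (com_of_dual a).
Proof.
rewrite /com_of_dual /= /one_dim_act /= scale1r (linZ (@dual_linear _ _ a)); congr (_ *: _).
rewrite -[LHS]/(sgn k s * (sgn k s^-1%g * a (nu m (dual_deg m e)))) mulrA.
by rewrite /sgn odd_permV -signr_addb addbb mul1r.
Qed.

Lemma dual_of_com_linear m e : linear (@dual_of_com m e).
Proof.
by move=> a x y; apply: dual_ext => v /=; rewrite gen_coef_lin mulrDl mulrA.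
Qed.

Lemma dual_of_com_act m e s (h : H m e) :
  dual_of_com (sm_act s h) = sm_act s (dual_of_com h).
Proof.
apply: dual_ext => v /=; rewrite /one_dim_act /= scale1r gen_coefZ.
have e1 : sgn k s * sgn k s^-1%g = 1 by rewrite /sgn odd_permV -signr_addb addbb.
by rewrite -[LHS]mul1r -e1; ring.
Qed.

Lemma dual_value m e (a : Ev m e) (v : E m (dual_deg m e)) :
  a v = a (nu m (dual_deg m e)) * gen_coef v.
Proof. by rewrite {1}(gen_coefE v) (linZ (@dual_linear _ _ a)) [_ *: _]mulrC. Qed.

Lemma gen_coef_idem m e (v : E m (dual_deg m e)) :
  ((m.+1 == N.+1) && (e == e0))%:R * gen_coef v = gen_coef v.
Proof.
by rewrite {2}(gen_coefE v) gen_coefZ gen_coef_generator dual_deg_eq mulrC.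
Qed.

Lemma gen_coef_com_of_dual m e (a : Ev m e) (v : E m (dual_deg m e)) :
  gen_coef (com_of_dual a) * gen_coef v = a v.
Proof. by rewrite gen_coefZ gen_coef_generator -mulrA gen_coef_idem -dual_value. Qed.

Lemma com_of_dualK m e : cancel (@com_of_dual m e) (@dual_of_com m e).
Proof. by move=> a; apply: dual_ext => v /=; rewrite gen_coef_com_of_dual. Qed.

Lemma dual_of_comK m e : cancel (@dual_of_com m e) (@com_of_dual m e).
Proof.
move=> h; rewrite /com_of_dual /= gen_coef_generator dual_deg_eq.
rewrite -(gen_coef_generator k N.+1 e0 false) -gen_coefZ.
rewrite -(gen_coefE (gen_coef h *: mu m e)).
exact: (esym (gen_coefE h)).
Qed.

Definition free_com_of_dual : forall m e, free_operad Ev m e -> free_operad H m e :=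
  free_ext (fun m e (a : Ev m e) => gen (com_of_dual a)).
Definition free_dual_of_com : forall m e, free_operad H m e -> free_operad Ev m e :=
  free_ext (fun m e (h : H m e) => gen (dual_of_com h)).

Lemma free_com_of_dual_morphism : operad_morphism free_com_of_dual.
Proof.
apply: free_ext_morphism => m e.
- by move=> a x y; rewrite com_of_dual_linear gen_linear.
- by move=> s x; rewrite com_of_dual_act gen_act.
Qed.

Lemma free_dual_of_com_morphism : operad_morphism free_dual_of_com.
Proof.
apply: free_ext_morphism => m e.
- by move=> a x y; rewrite dual_of_com_linear gen_linear.
- by move=> s x; rewrite dual_of_com_act gen_act.
Qed.

Lemma free_com_of_dual_gen m e (a : Ev m e) :
  free_com_of_dual (gen a) = gen (com_of_dual a).
Proof.
apply: free_ext_gen => m' e'.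
- by move=> b x y; rewrite com_of_dual_linear gen_linear.
- by move=> s x; rewrite com_of_dual_act gen_act.
Qed.

Lemma free_dual_of_com_gen m e (h : H m e) :
  free_dual_of_com (gen h) = gen (dual_of_com h).
Proof.
apply: free_ext_gen => m' e'.
- by move=> b x y; rewrite dual_of_com_linear gen_linear.
- by move=> s x; rewrite dual_of_com_act gen_act.
Qed.

Lemma free_com_of_dualK m e (x : free_operad Ev m e) :
  free_dual_of_com (free_com_of_dual x) = x.
Proof.
apply: (free_morphism_eq (morphism_comp free_com_of_dual_morphism free_dual_of_com_morphism)
  (morphism_id _)) => m' e' a.
by rewrite free_com_of_dual_gen free_dual_of_com_gen com_of_dualK.
Qed.

Lemma free_dual_of_comK m e (x : free_operad H m e) :
  free_com_of_dual (free_dual_of_com x) = x.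
Proof.
apply: (free_morphism_eq (morphism_comp free_dual_of_com_morphism free_com_of_dual_morphism)
  (morphism_id _)) => m' e' a.
by rewrite free_dual_of_com_gen free_com_of_dual_gen dual_of_comK.
Qed.

Lemma free_com_of_dual_circ (A : {set T}) e e' (a : Ev N e) (b : Ev N e') :
  free_com_of_dual (@circ_at k N.+1 Ev A e e' a b) =
  @circ_at k N.+1 H A e e' (com_of_dual a) (com_of_dual b).
Proof.
rewrite /circ_at (om_act free_com_of_dual_morphism) (om_comp free_com_of_dual_morphism).
by rewrite !free_com_of_dual_gen.
Qed.

Lemma free_dual_of_com_circ (A : {set T}) e e' (a : H N e) (b : H N e') :
  free_dual_of_com (@circ_at k N.+1 H A e e' a b) =
  @circ_at k N.+1 Ev A e e' (dual_of_com a) (dual_of_com b).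
Proof.
rewrite /circ_at (om_act free_dual_of_com_morphism) (om_comp free_dual_of_com_morphism).
by rewrite !free_dual_of_com_gen.
Qed.

(** The coordinates are linear on the whole free operad, so this is bilinear on
    all of it and not only in weight 2. *)
Definition pairing m e d' (x : free_operad Ev m e) (y : free_operad E m d') : k :=
  \sum_(A : {set T} | #|A| == N) coord (nat_set A) (free_com_of_dual x) * coord (nat_set A) y.

Lemma pairing_linl m e d' (y : free_operad E m d') :
  linear (fun x : free_operad Ev m e => pairing x y : k^o).
Proof.
move=> a x x'; rewrite -[RHS]/(a * pairing x y + pairing x' y) /pairing mulr_sumr.
rewrite -big_split; apply: eq_bigr => A _ /=.
by rewrite (om_linear free_com_of_dual_morphism) coord_linear mulrDl mulrA.
Qed.

Lemma pairing_linr m e d' (x : free_operad Ev m e) :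
  linear (fun y : free_operad E m d' => pairing x y : k^o).
Proof.
move=> a y y'; rewrite -[RHS]/(a * pairing x y + pairing x y') /pairing mulr_sumr.
rewrite -big_split; apply: eq_bigr => A _ /=.
by rewrite coord_linear mulrDr; congr (_ + _); apply: mulrCA.
Qed.

Lemma pairing_weight2 : @weight2_pairing k N.+1 E pairing.
Proof.
split.
- exact: pairing_linl.
- exact: pairing_linr.
move=> A A' e e' a b x y cA cA'; rewrite /pairing (bigD1 A) /=; last exact/eqP.
rewrite big1 ?addr0; last first.
  move=> B /andP[_ BA]; rewrite free_com_of_dual_circ coord_circ_at //.
  by rewrite eq_sym (negbTE BA) mulr0 mul0r.
rewrite free_com_of_dual_circ !coord_circ_at // eqxx mulr1 [A' == A]eq_sym.
case: (A == A'); last by rewrite !mulr0.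
by rewrite mulr1 mulrACA !gen_coef_com_of_dual.
Qed.

End Duality.

(** * The annihilator of the n-Lie relations *)

Section Annihilator.
Variables (k : fieldType) (N : nat) (d : int).
Hypothesis char0 : [pchar k] =i pred0.
Hypothesis N_gt0 : (0 < N)%N.
Local Notation T := 'I_(N + N).+1.
Local Notation L := (last_block N.+1 : {set T}).
Local Notation e0 := (- d + N.+1%:Z - 2).
Local Notation E := (one_dim k N.+1 d true).
Local Notation H := (one_dim k N.+1 e0 false).
Local Notation Ev := (dual_smod E).
Local Notation nu := (generator k N.+1 d true).
Local Notation mu := (generator k N.+1 e0 false).
Local Notation gcircE := (@gen_circ k N.+1 d true).
Local Notation gcircH := (@gen_circ k N.+1 e0 false).
Local Notation toH := (@free_com_of_dual k N d).
Local Notation toEv := (@free_dual_of_com k N d).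

Lemma act_nCom_relator (s : 'S_(N + N).+1) :
  sm_act s (nCom_relator k N.+1 e0) =
  combination e0 false (moved_polytabloid k (columns N) L s).
Proof.
have lb := @sm_act_linear k (free_operad H) (N + N)%N (e0 + e0) s.
rewrite /nCom_relator (lin_sum lb) column_stabilizerE.
rewrite /combination /moved_polytabloid /antisymmetrize.
under [RHS]eq_bigr do rewrite scaler_suml.
rewrite [RHS]exchange_big; apply: eq_bigr => t _.
have ct : #|t @^-1: L| = N by rewrite card_preim card_last_block.
rewrite (linZ lb) act_gen_circ // /chi scale1r.
have := @combination_delta k N e0 false (s @^-1: (t @^-1: L)) (sgn k t).
by rewrite card_preim => /(_ ct) <-.
Qed.

Section AnyPairing.
Variable B : forall m e d', free_operad Ev m e -> free_operad E m d' -> k.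
Hypothesis BP : @weight2_pairing k N.+1 E B.

(** The degree D is kept as a variable because d and [dual_deg N e0] are equal
    but not convertible. *)
Lemma pairing_circ (A A' : {set T}) D : D = dual_deg N e0 -> #|A| = N -> #|A'| = N ->
  B (@circ_at k N.+1 Ev A e0 e0 (dual_of_com (mu N e0)) (dual_of_com (mu N e0)))
    (@circ_at k N.+1 E A' D D (nu N D) (nu N D)) = (A == A')%:R.
Proof.
move=> -> cA cA'; have hD : dual_deg N e0 = d by rewrite /dual_deg; lia.
rewrite (wp_circ BP) //= !gen_coef_generator {}hD !eqxx !mulr1.
by case: (A == A').
Qed.

Lemma pairing_combination c (A' : {set T}) : #|A'| = N ->
  B (toEv (combination e0 false c)) (gcircE A') = c A'.
Proof.
move=> cA'; rewrite /combination (om_sum (free_dual_of_com_morphism _ _ _)).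
rewrite (lin_sum (@wp_linl _ _ _ _ BP _ _ _ (gcircE A'))).
have hD : d = dual_deg N e0 by rewrite /dual_deg; lia.
have term (A : {set T}) : #|A| == N ->
    B (toEv (c A *: gcircH A)) (gcircE A') = c A * (A == A')%:R.
  move=> /eqP cA; rewrite (omZ (free_dual_of_com_morphism _ _ _)).
  rewrite (linZ (@wp_linl _ _ _ _ BP _ _ _ (gcircE A'))) free_dual_of_com_circ.
  by congr (_ * _); apply: pairing_circ.
rewrite (eq_bigr _ term) (bigD1 A') ?cA' //= eqxx mulr1 big1 ?addr0 //.
by move=> A /andP[_ /negbTE ->]; rewrite mulr0.
Qed.

(** The sets occurring in the relator are the last block L and the sets ~L - i,
    so this is the equation defining [relator_value], moved by b. *)
Lemma pairing_relator c (b : 'S_(N + N).+1) :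
  B (toEv (combination e0 false c)) (sm_act b (nLie_relator k N.+1 d)) =
  chi k true b * relator_value N c (b @^-1: L).
Proof.
have lb := @sm_act_linear k (free_operad E) (N + N)%N (d + d) b.
have lB := @wp_linr _ _ _ _ BP (N + N)%N (e0 + e0) (d + d) (toEv (combination e0 false c)).
have term (A : {set T}) : #|A| = N ->
    B (toEv (combination e0 false c)) (sm_act b (gcircE A)) = chi k true b * c (b @^-1: A).
  move=> cA; rewrite act_gen_circ // (linZ lB); congr (_ * _).
  by rewrite pairing_combination // card_preim.
rewrite -relator_value_perm relator_value_last_block // /nLie_relator.
rewrite (linD lb) (linZ lb) (lin_sum lb).
rewrite (linD lB) (linZ lB) (lin_sum lB) term ?card_last_block //.
rewrite (eq_bigr (fun i : 'I_N.+1 => chi k true b *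
    c (b @^-1: [set j : T | (j < N.+1)%N && (j != i :> nat)]))) => [|i _]; last first.
  by rewrite term // card_not_last.
by rewrite -mulr_sumr mulrDr; congr (_ + _); apply: mulrCA.
Qed.

End AnyPairing.

(** The coordinates of an element of the annihilator form an eigenvector, hence a
    combination of polytabloids, which are the coordinates of the translates of
    the n-Com relator. *)
Lemma annihilator_nCom m e (x : free_operad Ev m e) :
  @annihilator k N.+1 E (@qd_rels k N.+1 (nLie_data k N.+1 d)) m e x ->
  sub_generated (singleton (nCom_relator k N.+1 e0)) (toH x).
Proof.
case=> w [B BP hB].
have := weight2_combination N_gt0 (weight2_ext (free_com_of_dual_morphism k N d)
   (@free_com_of_dual_gen k N d) w).
have sub := sub_generated_sub (singleton (nCom_relator k N.+1 e0)).
case: (pselect ((m, e) = ((N + N)%N, e0 + e0))) => [h [/(_ h) [c hc] _]|h [_ /(_ h) ->]];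
  last exact: (ss0 sub).
move: h => [em ee]; subst m e; move/shom_inj: hc => hc; rewrite hc.
pose y (A : {set T}) := if #|A| == N then c A else 0.
have -> : combination e0 false c = combination e0 false y.
  by apply: eq_bigr => A cA; rewrite /y cA.
have xE : x = toEv (combination e0 false c) by rewrite -hc free_com_of_dualK.
have [c' hc'] : exists c' : {perm T} -> k, forall A,
    y A = \sum_s c' s * moved_polytabloid k (columns N) L s A.
  apply: (relator_kernel_span char0 _ (uniq_columns N_gt0) (size_columns N)
    (selects_columns N_gt0)); rewrite ?card_ord ?card_last_block //.
    by move=> A /eqP/negbTE cA; rewrite /y cA.
  move=> A cA.
  have -> : relator_value N y A = relator_value N c A.
    rewrite /relator_value /y cA eqxx; congr (_ + _ * _); apply: eq_bigr => b bA.
    by rewrite (card_co (N := N)) ?card_ord ?eqxx.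
  have [oe ee] := even_perm_atP N_gt0 cA.
  have := pairing_relator BP c (@even_perm_at N.+1 A); rewrite (chi_even k true oe) mul1r ee.
  move=> <-; rewrite -xE; apply: hB.
  by apply: (ss_act (sub_generated_sub _)) => M _; apply.
have -> : combination e0 false y = \sum_s c' s *: sm_act s (nCom_relator k N.+1 e0).
  under [RHS]eq_bigr do rewrite act_nCom_relator /combination scaler_sumr.
  rewrite exchange_big /=; apply: eq_bigr => A _.
  by rewrite hc' scaler_suml; apply: eq_bigr => s _; rewrite scalerA.
elim/big_rec: _ => [|s z _ hz]; first exact: (ss0 sub).
by apply: (ss_lin sub) => //; apply: (ss_act sub) => M _; apply.
Qed.

(** The n-Com relator is a polytabloid, hence an eigenvector, hence orthogonal
    to every translate of the n-Lie relator. *)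
Lemma nCom_annihilator m e (x : free_operad H m e) :
  singleton (nCom_relator k N.+1 e0) x ->
  @annihilator k N.+1 E (@qd_rels k N.+1 (nLie_data k N.+1 d)) m e (toEv x).
Proof.
move=> h; have [em ee] := shom_tag h; subst m e; move/shom_inj: h => ->.
have w := weight2_ext (free_dual_of_com_morphism k N d) (@free_dual_of_com_gen k N d)
   (@nCom_relator_weight2 k N.+1 e0).
split=> //; exists (@pairing k N d); first exact: pairing_weight2.
have rE : nCom_relator k N.+1 e0 =
    combination e0 false (moved_polytabloid k (columns N) L 1%g).
  by rewrite -act_nCom_relator sm_act1.
(* The elements orthogonal to one fixed z need not be stable under the symmetric
   group, so all their translates are required to be orthogonal to z. *)
pose K : family (free_operad E) := fun m d' y =>
  forall e (z : free_operad Ev m e), shom z = shom (toEv (nCom_relator k N.+1 e0)) ->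
  forall b, pairing z (sm_act b y) = 0.
move=> d' y /(_ K) hy; suff : K _ _ y.
  by move=> /(_ _ _ erefl 1%g); rewrite sm_act1.
apply: hy; first split.
- move=> m d1 e z _ b; rewrite (lin0 (@sm_act_linear _ _ _ _ b)).
  exact: (lin0 (pairing_linr z)).
- move=> m d1 a u v hu hv e z hz b; rewrite sm_act_linear (pairing_linr z).
  by rewrite hu // hv // scaler0 addr0.
- by move=> m d1 s u hu e z hz b; rewrite sm_actM hu.
move=> m d1 u hu; have [em ed] := shom_tag hu; subst m d1; move/shom_inj: hu => ->.
move=> e z hz b; have [ee] := shom_tag hz; subst e; move/shom_inj: hz => ->.
rewrite rE pairing_relator; last exact: pairing_weight2.
apply/eqP; rewrite mulf_eq0; apply/orP; right; apply/eqP.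
apply: moved_polytabloid_relator_value;
  rewrite ?card_ord ?size_columns ?card_preim ?card_last_block //.
exact: uniq_columns.
Qed.

End Annihilator.

(** * The isomorphism of quadratic operads *)

Lemma proj_eq0 (k : fieldType) (P : operad k) (I : family P) (HI : operadic_ideal I) m e
    (x : P m e) : I m e x -> operad_proj HI x = 0.
Proof. by move=> hx; rewrite -(om0 (proj_morphism HI)); apply/proj_eq; rewrite subr0. Qed.

Section Isomorphism.
Variables (k : fieldType) (N : nat) (d : int).
Hypothesis char0 : [pchar k] =i pred0.
Hypothesis N_gt0 : (0 < N)%N.
Local Notation e0 := (- d + N.+1%:Z - 2).
Local Notation E := (one_dim k N.+1 d true).
Local Notation Ev := (dual_smod E).
Local Notation K := (koszul_dual (nLie_data k N.+1 d)).
Local Notation C := (nCom k N.+1 e0).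
Local Notation IK := (ideal_generated_ideal
  (@annihilator k N.+1 E (@qd_rels k N.+1 (nLie_data k N.+1 d)))).
Local Notation IC := (ideal_generated_ideal (@qd_rels k N.+1 (nCom_data k N.+1 e0))).

Definition to_nCom m e (x : free_operad Ev m e) : C m e :=
  operad_proj IC (@free_com_of_dual k N d m e x).

Definition to_koszul_dual m e (x : free_operad (one_dim k N.+1 e0 false) m e) : K m e :=
  operad_proj IK (@free_dual_of_com k N d m e x).

Lemma to_nCom_morphism : operad_morphism to_nCom.
Proof. exact: (morphism_comp (free_com_of_dual_morphism k N d) (proj_morphism IC)). Qed.

Lemma to_koszul_dual_morphism : operad_morphism to_koszul_dual.
Proof. exact: (morphism_comp (free_dual_of_com_morphism k N d) (proj_morphism IK)). Qed.

Lemma to_nCom_kills m e (x : free_operad Ev m e) :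
  ideal_generated (@annihilator k N.+1 E (@qd_rels k N.+1 (nLie_data k N.+1 d))) x ->
  to_nCom x = 0.
Proof.
apply: (ideal_generated_kernel to_nCom_morphism) => {}m {}e {}x hx.
apply: proj_eq0 => I HI; apply; exact: annihilator_nCom hx.
Qed.

Lemma to_koszul_dual_kills m e (x : free_operad (one_dim k N.+1 e0 false) m e) :
  ideal_generated (@qd_rels k N.+1 (nCom_data k N.+1 e0)) x -> to_koszul_dual x = 0.
Proof.
apply: (ideal_generated_kernel to_koszul_dual_morphism) => {}m {}e {}x.
move=> /(_ (fun m e x => to_koszul_dual x = 0)); apply.
  exact: oi_sub (kernel_ideal to_koszul_dual_morphism).
move=> m' e' y hy; apply: proj_eq0 => I HI; apply; exact: nCom_annihilator hy.
Qed.

Theorem koszul_dual_nLie : exists f : forall m e, K m e -> C m e,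
  operad_isomorphism f /\
  forall m e (a : dual_smod (qd_gens (nLie_data k N.+1 d)) m e),
    f m e (koszul_dual_gen a) =
    a (nLie_nu k N.+1 d m (dual_deg m e)) *: nCom_mu k N.+1 e0 m e.
Proof.
have tm := to_nCom_morphism; have om := to_koszul_dual_morphism.
exists (quotient_lift (HI := IK) to_nCom); split.
  split; first exact: (quotient_lift_morphism IK tm to_nCom_kills).
  move=> m e; exists (@quotient_lift k _ _ IC _ to_koszul_dual m e) => x.
    have [t ->] := projP x.
    rewrite (quotient_liftE IK tm to_nCom_kills) (quotient_liftE IC om to_koszul_dual_kills).
    by rewrite /to_koszul_dual free_com_of_dualK.
  have [t ->] := projP x.
  rewrite (quotient_liftE IC om to_koszul_dual_kills) (quotient_liftE IK tm to_nCom_kills).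
  by rewrite /to_nCom free_dual_of_comK.
move=> m e a; rewrite (quotient_liftE IK tm to_nCom_kills) /to_nCom free_com_of_dual_gen.
by rewrite /com_of_dual (linZ (@gen_linear k _ _ _)) (omZ (proj_morphism IC)).
Qed.

End Isomorphism.

(* The isomorphism is the one induced by the identification of the dual of the
   generators of n-Lie_d with the generators of n-Com_(-d+n-2), under which mu is
   the dual basis element of nu: a form a on k nu is sent to a(nu) mu. *)
Theorem theorem0p1 (k : fieldType) (hk : [pchar k] =i pred0)
    (n : nat) (hn : (2 <= n)%N) (d : int) :
  exists f : forall m e,
      koszul_dual (nLie_data k n d) m e -> nCom k n (- d + n%:Z - 2) m e,
    operad_isomorphism f /\
    forall m e (a : dual_smod (qd_gens (nLie_data k n d)) m e),
      f m e (koszul_dual_gen a) =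
      a (nLie_nu k n d m (dual_deg m e)) *: nCom_mu k n (- d + n%:Z - 2) m e.
Proof. by case: n hn => [|N] // hN; apply: koszul_dual_nLie. Qed.
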